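(* A minimum-area 1-2 drawing of a complete ternary tree can be computed in polynomial time; that is, there is an algorithm that, given $h$, computes a 1-2 drawing of $T_h$ whose area is minimum among all 1-2 drawings of $T_h$, in time polynomial in the number $n=(3^h-1)/2$ of nodes of $T_h$.
   Context: $T_h$ denotes the complete ternary tree: every non-leaf node has exactly three children and every root-to-leaf path has exactly $h$ nodes. A drawing is a planar straight-line orthogonal grid drawing: nodes at distinct integer points, edges horizontal or vertical segments, no crossings; width (height) is the number of vertical (horizontal) grid lines intersecting it, area is width times height. 1-2 drawings of $T_h$ are defined recursively: for $h=1$, a single node at a grid point. For $h\ge2$, take any three (not necessarily congruent) 1-2 drawings $\Gamma^a,\Gamma^b,\Gamma^c$ of $T_{h-1}$ and combine them by Construction 1 or Construction 2. Construction 1: place the root $r$ of $T_h$ at a grid point; translate $\Gamma^a$ so that its topmost grid row is one unit below $r$ and its root is on the vertical line through $r$; rotate $\Gamma^b$ clockwise by $90^\circ$ and place it so its rightmost grid column is one unit left of the leftmost column of $\Gamma^a$, its root on the horizontal line through $r$; rotate $\Gamma^c$ counterclockwise by $90^\circ$ and place it so its leftmost column is one unit right of the rightmost column of $\Gamma^a$, its root on the horizontal line through $r$; connect $r$ to the three roots. Construction 2: place $r$; rotate $\Gamma^b$ clockwise by $90^\circ$ and place it so its rightmost column is one unit left of $r$, its root on the horizontal line through $r$; rotate $\Gamma^c$ counterclockwise by $90^\circ$ and place it so its leftmost column is one unit right of $r$, its root on the horizontal line through $r$; place $\Gamma^a$ so its topmost row is one unit below the lowest row intersecting $\Gamma^b$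 or $\Gamma^c$, its root on the vertical line through $r$; connect $r$ to the three roots. *)

(* Defs.v *)
From HB Require Import structures.
From mathcomp Require Import all_boot all_order all_algebra.

Set Implicit Arguments.
Unset Strict Implicit.
Unset Printing Implicit Defensive.

Import Order.TTheory GRing.Theory Num.Theory.
Local Open Scope ring_scope.

(* Grid points (x, y); x grows rightwards and y grows upwards. *)
Definition point := (int * int)%type.

(* The points at which the nodes of a ternary tree are placed.  In
   [DNode r a b c] the subtrees are those called Gamma^a, Gamma^b, Gamma^c in
   the two constructions. *)
Inductive drawing : Type :=
| DLeaf of point
| DNode of point & drawing & drawing & drawing.

Definition root_pt (D : drawing) : point :=
  match D with DLeaf p => p | DNode p _ _ _ => p end.

Fixpoint map_drawing (f : point -> point) (D : drawing) : drawing :=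
  match D with
  | DLeaf p => DLeaf (f p)
  | DNode p a b c =>
      DNode (f p) (map_drawing f a) (map_drawing f b) (map_drawing f c)
  end.

Definition translate (v : point) : drawing -> drawing :=
  map_drawing (fun p => (p.1 + v.1, p.2 + v.2)).

(* Rotations by 90 degrees about the origin. *)
Definition rot_cw : drawing -> drawing := map_drawing (fun p => (p.2, - p.1)).
Definition rot_ccw : drawing -> drawing := map_drawing (fun p => (- p.2, p.1)).

(* A leaf contributes a degenerate segment, so that every node lies on one. *)
Fixpoint segments (D : drawing) : seq (point * point) :=
  match D with
  | DLeaf p => [:: (p, p)]
  | DNode p a b c =>
      [:: (p, root_pt a); (p, root_pt b); (p, root_pt c)]
        ++ segments a ++ segments b ++ segments c
  end.

(* The integers k with min x y <= k <= max x y. *)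
Definition int_span (x y : int) : seq int :=
  [seq Num.min x y + i%:Z | i <- iota 0 `|x - y|%N.+1].

(* Abscissae of the vertical (ordinates of the horizontal) grid lines that
   intersect the drawing, without repetition. *)
Definition cols (D : drawing) : seq int :=
  undup (flatten [seq int_span s.1.1 s.2.1 | s <- segments D]).
Definition rows (D : drawing) : seq int :=
  undup (flatten [seq int_span s.1.2 s.2.2 | s <- segments D]).

Definition width (D : drawing) : nat := size (cols D).
Definition height (D : drawing) : nat := size (rows D).
Definition area (D : drawing) : nat := (width D * height D)%N.

(* Least and greatest entry of a nonempty list (0 for the empty one; [cols D]
   and [rows D] are never empty). *)
Definition min_list (s : seq int) : int := foldr Num.min (head 0 s) s.
Definition max_list (s : seq int) : int := foldr Num.max (head 0 s) s.

Definition leftmost (D : drawing) : int := min_list (cols D).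
Definition rightmost (D : drawing) : int := max_list (cols D).
Definition lowest (D : drawing) : int := min_list (rows D).
Definition topmost (D : drawing) : int := max_list (rows D).

(* In both constructions [a], [b], [c] are the given drawings of the subtrees,
   and [a'], [b'], [c'] the copies that appear in the result. *)
Definition construction1 (r : point) (a b c D : drawing) : Prop :=
  exists va vb vc : point,
    let a' := translate va a in
    let b' := translate vb (rot_cw b) in
    let c' := translate vc (rot_ccw c) in
    [/\ topmost a' = r.2 - 1 /\ (root_pt a').1 = r.1,
        rightmost b' = leftmost a' - 1 /\ (root_pt b').2 = r.2,
        leftmost c' = rightmost a' + 1 /\ (root_pt c').2 = r.2
      & D = DNode r a' b' c'].

Definition construction2 (r : point) (a b c D : drawing) : Prop :=
  exists va vb vc : point,
    let a' := translate va a in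
    let b' := translate vb (rot_cw b) in
    let c' := translate vc (rot_ccw c) in
    [/\ rightmost b' = r.1 - 1 /\ (root_pt b').2 = r.2,
        leftmost c' = r.1 + 1 /\ (root_pt c').2 = r.2,
        topmost a' = Num.min (lowest b') (lowest c') - 1
          /\ (root_pt a').1 = r.1
      & D = DNode r a' b' c'].

(* [drawing12 h D]: D is a 1-2 drawing of the complete ternary tree with h
   levels.  The index h forces the shape of the tree; there is none for 0. *)
Inductive drawing12 : nat -> drawing -> Prop :=
| D12_leaf p : drawing12 1 (DLeaf p)
| D12_cons1 h r a b c D :
    drawing12 h a -> drawing12 h b -> drawing12 h c ->
    construction1 r a b c D -> drawing12 h.+1 D
| D12_cons2 h r a b c D :
    drawing12 h a -> drawing12 h b -> drawing12 h c ->
    construction2 r a b c D -> drawing12 h.+1 D.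

Definition min_area_drawing12 (h : nat) (D : drawing) : Prop :=
  drawing12 h D /\ forall D', drawing12 h D' -> (area D <= area D')%N.

Definition num_nodes (h : nat) : nat := ((3 ^ h - 1) %/ 2)%N.

(* Model of computation: while programs on a random access machine with
   integer cells, indirect addressing, and uniform cost.  There is no
   multiplication, so each step lengthens integers by O(1) bits only, and
   polynomial time is the same as for Turing machines. *)
Definition memory := int -> int.

Inductive expr : Type :=
| Const of int
| Read of expr
| Add of expr & expr
| Sub of expr & expr.

Inductive program : Type :=
| Skip
| Write of expr & expr
| Seq of program & program
| IfPos of expr & program & program
| WhilePos of expr & program.

Fixpoint eval (m : memory) (e : expr) : int :=
  match e with
  | Const z => z
  | Read e1 => m (eval m e1)
  | Add e1 e2 => eval m e1 + eval m e2
  | Sub e1 e2 => eval m e1 - eval m e2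
  end.

Fixpoint eval_cost (e : expr) : nat :=
  match e with
  | Const _ => 1
  | Read e1 => (eval_cost e1).+1
  | Add e1 e2 | Sub e1 e2 => (eval_cost e1 + eval_cost e2).+1
  end%N.

Definition update (m : memory) (k v : int) : memory :=
  fun i => if i == k then v else m i.

(* [exec P m t m']: started in memory m, program P halts after exactly t steps
   in memory m'. *)
Inductive exec : program -> memory -> nat -> memory -> Prop :=
| exec_skip m : exec Skip m 1 m
| exec_write m e1 e2 :
    exec (Write e1 e2) m (eval_cost e1 + eval_cost e2).+1
      (update m (eval m e1) (eval m e2))
| exec_seq P Q m1 m2 m3 t1 t2 :
    exec P m1 t1 m2 -> exec Q m2 t2 m3 -> exec (Seq P Q) m1 (t1 + t2) m3
| exec_if_true e P Q m m' t :
    0 < eval m e -> exec P m t m' ->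
    exec (IfPos e P Q) m (eval_cost e + t).+1 m'
| exec_if_false e P Q m m' t :
    eval m e <= 0 -> exec Q m t m' ->
    exec (IfPos e P Q) m (eval_cost e + t).+1 m'
| exec_while_false e P m :
    eval m e <= 0 -> exec (WhilePos e P) m (eval_cost e).+1 m
| exec_while_true e P m1 m2 m3 t1 t2 :
    0 < eval m1 e -> exec P m1 t1 m2 -> exec (WhilePos e P) m2 t2 m3 ->
    exec (WhilePos e P) m1 (eval_cost e + t1 + t2).+1 m3.

(* The input h is in cell 0, every other cell holds 0. *)
Definition input_memory (h : nat) : memory :=
  fun i => if i == 0 then h%:Z else 0.

(* The coordinates x, y of the nodes in preorder.  For a complete tree this
   list determines the drawing. *)
Fixpoint encode (D : drawing) : seq int :=
  match D with
  | DLeaf p => [:: p.1; p.2]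
  | DNode p a b c => [:: p.1; p.2] ++ encode a ++ encode b ++ encode c
  end.

(* The output is read from cells 0, 1, 2, ... *)
Definition outputs (m : memory) (D : drawing) : Prop :=
  forall i : nat, (i < size (encode D))%N -> m i%:Z = nth 0 (encode D) i.

(* Main.v *)
Require Import Defs.
From mathcomp Require Import all_boot all_order all_algebra.
From mathcomp Require Import zify ring.

(* The width and height of a drawing assembled by either construction depend
   on the three parts only through their extents to the left and to the right
   of the root and through their heights.  By induction these numbers are less
   than the number n of nodes, so drawings of a given level fall into at most
   n^3 classes, and one representative per class is enough.  The algorithm goes
   through the levels, combines all triples of representatives of the previous
   level in both ways, discards a result if its class has already been met, and
   finally scans the last level for the smallest area. *)

Set Implicit Arguments.
Unset Strict Implicit.
Unset Printing Implicit Defensive.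

Import Order.TTheory GRing.Theory Num.Theory.
Local Open Scope ring_scope.

(** * Extents of 1-2 drawings *)

(** Three numbers suffice because of the rotations. The turned copies of [b] and [c] contribute
    their horizontal extents to the vertical ones of the result, while their vertical extents, and
    those of [a], enter only as sums. The upward extent of the result is the larger of a left extent
    of [b] and a right extent of [c]. So how the height of a part splits at its root affects only
    where that part is put, and exchanging a part for another one of its class preserves the class
    of the whole. The split is still stored, since the coordinates to be output depend on it. With
    [N] the final number of nodes there are at most [N] levels, each level considers at most [N ^ 9]
    triples, and each candidate is compared with at most [N ^ 3] stored records, so the time is
    polynomial. All explicit constants in time bounds are generous. The programs are verified
    against a purely functional description, [level], whose lists are reproduced in memory in the
    same order. *)

Lemma mem_int_span a b x :
  (x \in int_span a b) = (Num.min a b <= x <= Num.max a b).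
Proof.
apply/mapP/idP => [[i]|H]; first by rewrite mem_iota => ? ->; lia.
by exists `|(x - Num.min a b)%R|%N; rewrite ?mem_iota; lia.
Qed.

Lemma mem_cols D x : (x \in cols D) =
  has (fun s : point * point => x \in int_span s.1.1 s.2.1) (segments D).
Proof.
rewrite /cols mem_undup; apply/flattenP/hasP => [[t /mapP[s sD ->] xs]|[s sD xs]].
  by exists s.
by exists (int_span s.1.1 s.2.1) => //; apply/mapP; exists s.
Qed.

Lemma mem_rows D y : (y \in rows D) =
  has (fun s : point * point => y \in int_span s.1.2 s.2.2) (segments D).
Proof.
rewrite /rows mem_undup; apply/flattenP/hasP => [[t /mapP[s sD ->] ys]|[s sD ys]].
  by exists s.
by exists (int_span s.1.2 s.2.2) => //; apply/mapP; exists s.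
Qed.

Lemma mem_cols_node p a b c x : (x \in cols (DNode p a b c)) =
  [|| x \in int_span p.1 (root_pt a).1, x \in int_span p.1 (root_pt b).1,
      x \in int_span p.1 (root_pt c).1, x \in cols a, x \in cols b | x \in cols c].
Proof. by rewrite !mem_cols /= !has_cat. Qed.

Lemma mem_rows_node p a b c y : (y \in rows (DNode p a b c)) =
  [|| y \in int_span p.2 (root_pt a).2, y \in int_span p.2 (root_pt b).2,
      y \in int_span p.2 (root_pt c).2, y \in rows a, y \in rows b | y \in rows c].
Proof. by rewrite !mem_rows /= !has_cat. Qed.

Lemma root_map f D : root_pt (map_drawing f D) = f (root_pt D).
Proof. by case: D. Qed.

Lemma segments_map f D :
  segments (map_drawing f D) = [seq (f s.1, f s.2) | s <- segments D].
Proof.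
elim: D => [p|p a IHa b IHb c IHc] //=.
by rewrite !map_cat IHa IHb IHc !root_map.
Qed.

(* The grid lines meeting [D] are those at distance at most [l], [r], [u], [d]
   to the left, right, top and bottom of the root. *)
Definition box (D : drawing) (l r u d : int) : Prop :=
  [/\ [&& 0 <= l, 0 <= r, 0 <= u & 0 <= d],
      forall x, (x \in cols D) = ((root_pt D).1 - l <= x <= (root_pt D).1 + r)
    & forall y, (y \in rows D) = ((root_pt D).2 - d <= y <= (root_pt D).2 + u)].

Lemma box_leaf p : box (DLeaf p) 0 0 0 0.
Proof. by split=> // z; rewrite ?mem_cols ?mem_rows /= mem_int_span; lia. Qed.

(** This covers maps acting on abscissae alone, with [g] undoing that action. Rotations exchange the
    coordinates and are treated directly from [segments_map]. *)
Lemma mem_cols_map f g D x :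
  (forall p q, (x \in int_span (f p).1 (f q).1) = (g x \in int_span p.1 q.1)) ->
  (x \in cols (map_drawing f D)) = (g x \in cols D).
Proof.
by move=> fg; rewrite !mem_cols segments_map has_map; apply: eq_has => s /=.
Qed.

Lemma mem_rows_map f g D y :
  (forall p q, (y \in int_span (f p).2 (f q).2) = (g y \in int_span p.2 q.2)) ->
  (y \in rows (map_drawing f D)) = (g y \in rows D).
Proof.
by move=> fg; rewrite !mem_rows segments_map has_map; apply: eq_has => s /=.
Qed.

Lemma box_translate v D l r u d : box D l r u d -> box (translate v D) l r u d.
Proof.
case=> lrud HC HR; split=> // z; rewrite root_map /=.
- rewrite (@mem_cols_map _ (fun x => x - v.1)) ?HC; first by lia.
  by move=> p q; rewrite !mem_int_span /=; lia.
- rewrite (@mem_rows_map _ (fun x => x - v.2)) ?HR; first by lia.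
  by move=> p q; rewrite !mem_int_span /=; lia.
Qed.

(** A clockwise quarter turn sends up to right, right to down, down to left and left to up. New
    abscissae are old ordinates; new ordinates are negated old abscissae, hence the passage through
    [- z] for the rows. *)
Lemma box_rot_cw D l r u d : box D l r u d -> box (rot_cw D) d u l r.
Proof.
case=> lrud HC HR; split; first by lia.
- by move=> z; rewrite root_map /= -HR mem_cols mem_rows segments_map has_map.
move=> z; rewrite root_map /= !mem_rows segments_map has_map.
have := HC (- z); rewrite mem_cols => E.
transitivity ((root_pt D).1 - l <= - z <= (root_pt D).1 + r); last by lia.
by rewrite -E; apply: eq_has => s /=; rewrite !mem_int_span; lia.
Qed.

Lemma box_rot_ccw D l r u d : box D l r u d -> box (rot_ccw D) u d r l.
Proof.
case=> lrud HC HR; split; first by lia.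
- move=> z; rewrite root_map /= !mem_cols segments_map has_map.
  have := HR (- z); rewrite mem_rows => E.
  transitivity ((root_pt D).2 - d <= - z <= (root_pt D).2 + u); last by lia.
  by rewrite -E; apply: eq_has => s /=; rewrite !mem_int_span; lia.
- by move=> z; rewrite root_map /= -HC mem_cols mem_rows segments_map has_map.
Qed.

(** The fold is seeded with the head of the list, itself an entry, so its value is an entry as well
    as a lower bound. The auxiliary facts are stated for an arbitrary seed to allow induction. *)
Lemma min_list_itv (s : seq int) (a b : int) : a <= b ->
  (forall x, (x \in s) = (a <= x <= b)) -> min_list s = a.
Proof.
move=> ab H.
have min_le (t : seq int) z x : x \in t -> foldr Num.min z t <= x.
  by elim: t => //= y t IH; rewrite inE ge_min => /orP[/eqP->|/IH->];
    rewrite ?lexx ?orbT.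
have min_in (t : seq int) z : (foldr Num.min z t == z) || (foldr Num.min z t \in t).
  elim: t => [|y t IH] /=; rewrite ?eqxx // inE minElt.
  by case: ifP => _; rewrite ?eqxx ?orbT // orbCA IH orbT.
have a_s : a \in s by rewrite H; lia.
have : min_list s \in s.
  rewrite /min_list; case: s {H} a_s => // y t _.
  by case/orP: (min_in (y :: t) y) => // /eqP->; exact: mem_head.
by rewrite H; have := min_le s (head 0 s) a a_s; rewrite -/(min_list s); lia.
Qed.

Lemma max_list_itv (s : seq int) (a b : int) : a <= b ->
  (forall x, (x \in s) = (a <= x <= b)) -> max_list s = b.
Proof.
move=> ab H.
have max_ge (t : seq int) z x : x \in t -> x <= foldr Num.max z t.
  by elim: t => //= y t IH; rewrite inE le_max => /orP[/eqP->|/IH->];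
    rewrite ?lexx ?orbT.
have max_in (t : seq int) z : (foldr Num.max z t == z) || (foldr Num.max z t \in t).
  elim: t => [|y t IH] /=; rewrite ?eqxx // inE maxElt.
  by case: ifP => _; rewrite ?eqxx ?orbT // orbCA IH orbT.
have b_s : b \in s by rewrite H; lia.
have : max_list s \in s.
  rewrite /max_list; case: s {H} b_s => // y t _.
  by case/orP: (max_in (y :: t) y) => // /eqP->; exact: mem_head.
by rewrite H; have := max_ge s (head 0 s) b b_s; rewrite -/(max_list s); lia.
Qed.

(** Such a list is a permutation of [int_span a b], whose length is known. *)
Lemma size_itv (s : seq int) (a b : int) : uniq s -> a <= b ->
  (forall x, (x \in s) = (a <= x <= b)) -> (size s)%:Z = b - a + 1.
Proof.
move=> us ab H.
have /uniq_perm : uniq (int_span a b).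
  by rewrite map_inj_uniq ?iota_uniq // => i j /=; lia.
move=> /(_ s us) P; have /perm_size <- : perm_eq (int_span a b) s.
  by apply: P => x; rewrite mem_int_span H; lia.
by rewrite size_map size_iota; lia.
Qed.

Lemma box_leftmost D l r u d : box D l r u d -> leftmost D = (root_pt D).1 - l.
Proof. by case=> ? H _; apply: min_list_itv H; lia. Qed.

Lemma box_rightmost D l r u d : box D l r u d -> rightmost D = (root_pt D).1 + r.
Proof. by case=> ? H _; apply: max_list_itv H; lia. Qed.

Lemma box_lowest D l r u d : box D l r u d -> lowest D = (root_pt D).2 - d.
Proof. by case=> ? _ H; apply: min_list_itv H; lia. Qed.

Lemma box_topmost D l r u d : box D l r u d -> topmost D = (root_pt D).2 + u.
Proof. by case=> ? _ H; apply: max_list_itv H; lia. Qed.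

Lemma box_area D l r u d :
  box D l r u d -> (area D)%:Z = (l + r + 1) * (u + d + 1).
Proof.
case=> ? HC HR; rewrite /area PoszM; congr (_ * _).
  by rewrite (size_itv _ _ HC) ?undup_uniq; lia.
by rewrite (size_itv _ _ HR) ?undup_uniq; lia.
Qed.

(** To the left of the root come [la] columns of [a], then the [ub + db + 1] columns of the turned
    [b]. The edges to the roots of [b] and [c] meet every column in between, so the columns form an
    interval. *)
Lemma box_construction1 r a b c D la ra ua da lb rb ub db lc rc uc dc :
  box a la ra ua da -> box b lb rb ub db -> box c lc rc uc dc ->
  construction1 r a b c D ->
  box D (la + 1 + (ub + db)) (ra + 1 + (uc + dc)) (Num.max lb rc)
    (Num.max (ua + da + 1) (Num.max rb lc)).
Proof.
move=> Ba Bb Bc [va [vb [vc]]] /=.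
have {Ba} := box_translate va Ba; move: (translate va a) => a' Ba.
have {Bb} := box_translate vb (box_rot_cw Bb).
move: (translate vb (rot_cw b)) => b' Bb.
have {Bc} := box_translate vc (box_rot_ccw Bc).
move: (translate vc (rot_ccw c)) => c' Bc.
rewrite (box_topmost Ba) (box_rightmost Bb) (box_leftmost Bc).
rewrite (box_leftmost Ba) (box_rightmost Ba).
case: Ba Bb Bc => a0 aC aR [b0 bC bR] [c0 cC cR] [Ha Hb Hc ->].
split=> /=; first by lia.
- by move=> z; rewrite mem_cols_node aC bC cC !mem_int_span; lia.
- by move=> z; rewrite mem_rows_node aR bR cR !mem_int_span; lia.
Qed.

Lemma box_construction2 r a b c D la ra ua da lb rb ub db lc rc uc dc :
  box a la ra ua da -> box b lb rb ub db -> box c lc rc uc dc ->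
  construction2 r a b c D ->
  box D (Num.max (1 + (ub + db)) la) (Num.max (1 + (uc + dc)) ra)
    (Num.max lb rc) (Num.max rb lc + 1 + (ua + da)).
Proof.
move=> Ba Bb Bc [va [vb [vc]]] /=.
have {Ba} := box_translate va Ba; move: (translate va a) => a' Ba.
have {Bb} := box_translate vb (box_rot_cw Bb).
move: (translate vb (rot_cw b)) => b' Bb.
have {Bc} := box_translate vc (box_rot_ccw Bc).
move: (translate vc (rot_ccw c)) => c' Bc.
rewrite (box_topmost Ba) (box_rightmost Bb) (box_leftmost Bc).
rewrite (box_lowest Bb) (box_lowest Bc).
case: Ba Bb Bc => a0 aC aR [b0 bC bR] [c0 cC cR] [Ha Hb Hc ->].
split=> /=; first by lia.
- by move=> z; rewrite mem_cols_node aC bC cC !mem_int_span; lia.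
- by move=> z; rewrite mem_rows_node aR bR cR !mem_int_span; lia.
Qed.

(** * Representatives of the drawings of a level *)

Fixpoint nodes (D : drawing) : seq point :=
  match D with
  | DLeaf p => [:: p]
  | DNode p a b c => p :: nodes a ++ nodes b ++ nodes c
  end.

Definition flat (ps : seq point) : seq int := flatten [seq [:: p.1; p.2] | p <- ps].

Lemma flat_cat ps qs : flat (ps ++ qs) = flat ps ++ flat qs.
Proof. by rewrite /flat map_cat flatten_cat. Qed.

Lemma size_flat ps : size (flat ps) = (2 * size ps)%N.
Proof. by elim: ps => //= p ps IH; rewrite -/(flat ps) IH; lia. Qed.

Lemma encodeE D : encode D = flat (nodes D).
Proof.
by elim: D => [//|p a IHa b IHb c IHc]; rewrite /= IHa IHb IHc -!flat_cat.
Qed.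

Lemma nodes_map f D : nodes (map_drawing f D) = map f (nodes D).
Proof.
by elim: D => [//|p a IHa b IHb c IHc]; rewrite /= IHa IHb IHc !map_cat.
Qed.

(* The left and right extents and the number of rows minus one, the upward
   extent, and the nodes in preorder, of a drawing whose root is at (0, 0).
   The first three numbers are all that the extents of a larger drawing depend
   on. *)
Definition record := (int * int * int * int * seq point)%type.
Definition key (R : record) : int * int * int := R.1.1.
Definition lft (R : record) : int := R.1.1.1.1.
Definition rgt (R : record) : int := R.1.1.1.2.
Definition ver (R : record) : int := R.1.1.2.
Definition upw (R : record) : int := R.1.2.
Definition pts (R : record) : seq point := R.2.

(* Rotation of the subtree, then translation by [d] down, left and right
   respectively. *)
Definition move_a (d : int) (p : point) : point := (p.1, p.2 - d).
Definition move_b (d : int) (p : point) : point := (p.2 - d, - p.1).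
Definition move_c (d : int) (p : point) : point := (d - p.2, p.1).

Definition join_pts (da db dc : int) (A B C : record) : seq point :=
  (0, 0) :: map (move_a da) (pts A) ++ map (move_b db) (pts B)
    ++ map (move_c dc) (pts C).

Definition join1 (A B C : record) : record :=
  (lft A + 1 + ver B, rgt A + 1 + ver C,
   Num.max (Num.max (ver A + 1) (rgt B)) (lft C) + Num.max (lft B) (rgt C),
   Num.max (lft B) (rgt C),
   join_pts (1 + upw A) (lft A + 1 + upw B) (rgt A + 1 + upw C) A B C).

Definition join2 (A B C : record) : record :=
  (Num.max (1 + ver B) (lft A), Num.max (1 + ver C) (rgt A),
   Num.max (rgt B) (lft C) + 1 + ver A + Num.max (lft B) (rgt C),
   Num.max (lft B) (rgt C),
   join_pts (Num.max (rgt B) (lft C) + 1 + upw A) (1 + upw B) (1 + upw C)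
     A B C).

(** The first record met with a given key survives, and new ones go to the end, as they do in
    memory. *)
Definition add_record (cur : seq record) (R : record) : seq record :=
  if key R \in map key cur then cur else rcons cur R.

(** The nesting of [joinsC], [joinsB] and [joins] follows the three nested loops of the program. *)
Definition joinsC A B prev := flatten [seq [:: join1 A B C; join2 A B C] | C <- prev].
Definition joinsB A prev := flatten [seq joinsC A B prev | B <- prev].
Definition joins prev : seq record := flatten [seq joinsB A prev | A <- prev].

Definition next_level (prev : seq record) : seq record :=
  foldl add_record [::] (joins prev).

Definition leaf_record : record := (0, 0, 0, 0, [:: (0, 0)]).
Definition level (h : nat) : seq record := iter h.-1 next_level [:: leaf_record].

Lemma foldl_add_sub z s R : R \in foldl add_record z s -> (R \in z) || (R \in s).
Proof.
elim: s z => [|x s IH] z /=; first by move=> ->.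
move/IH; rewrite /add_record inE; case: ifP => _; last rewrite mem_rcons inE;
  by do ?[case/orP|move=> ->; rewrite ?orbT].
Qed.

Lemma foldl_add_key z s k : (k \in map key (foldl add_record z s)) =
  (k \in map key z) || (k \in map key s).
Proof.
elim: s z => [|x s IH] z /=; first by rewrite orbF.
rewrite IH /add_record inE; case: ifP => xz; last first.
  by rewrite map_rcons mem_rcons inE -orbA orbCA.
by case: eqP => [->|//]; rewrite xz.
Qed.

Lemma foldl_add_uniq z s :
  uniq (map key z) -> uniq (map key (foldl add_record z s)).
Proof.
elim: s z => [|x s IH] z //= uz; apply: IH; rewrite /add_record; case: ifP => // xz.
by rewrite map_rcons rcons_uniq xz.
Qed.

Lemma mem_joinsP prev R : reflect
  (exists A B C, [/\ A \in prev, B \in prev, C \in prev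
     & R = join1 A B C \/ R = join2 A B C]) (R \in joins prev).
Proof.
apply: (iffP flatten_mapP).
  case=> A Ap /flatten_mapP[B Bp /flatten_mapP[C Cp]].
  rewrite !inE => H; exists A, B, C; split=> //.
  by case/orP: H => /eqP; [left|right].
case=> A [B [C [Ap Bp Cp H]]]; exists A => //; apply/flatten_mapP; exists B => //.
apply/flatten_mapP; exists C => //; rewrite !inE.
by case: H => ->; rewrite eqxx ?orbT.
Qed.

Lemma levelS h : (0 < h)%N -> level h.+1 = next_level (level h).
Proof. by case: h. Qed.

Lemma num_nodesS h : num_nodes h.+1 = (3 * num_nodes h + 1)%N.
Proof.
rewrite /num_nodes expnS; have : odd (3 ^ h)%N by rewrite oddX orbT.
by move: (3 ^ h)%N => k; lia.
Qed.

Definition sound (h : nat) (R : record) : Prop :=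
  exists D : drawing, [/\ drawing12 h D, root_pt D = (0, 0), nodes D = pts R
    & box D (lft R) (rgt R) (upw R) (ver R - upw R)].

Lemma nodes_join a b c A B C da db dc :
  nodes a = pts A -> nodes b = pts B -> nodes c = pts C ->
  nodes (DNode (0, 0) (translate (0, - da) a) (translate (- db, 0) (rot_cw b))
     (translate (dc, 0) (rot_ccw c))) = join_pts da db dc A B C.
Proof.
move=> aA bB cC; rewrite /= /translate /rot_cw /rot_ccw !nodes_map -!map_comp.
rewrite aA bB cC; congr (_ :: _ ++ _ ++ _); apply: eq_map => -[x y] /=;
  by rewrite /move_a /move_b /move_c /=; congr pair; ring.
Qed.

Lemma sound_join1 h A B C :
  sound h A -> sound h B -> sound h C -> sound h.+1 (join1 A B C).
Proof.
move=> [a [a12 ra na Ba]] [b [b12 rb nb Bb]] [c [c12 rc nc Bc]].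
(* The roots start at the origin. The rotations turn the upward extent of [b] into its rightward one
   and that of [c] into its leftward one, whence [upw B] and [upw C] in the horizontal shifts. *)
pose va := (0, - (1 + upw A)) : point; pose vb := (- (lft A + 1 + upw B), 0) : point.
pose vc := (rgt A + 1 + upw C, 0) : point.
exists (DNode (0, 0) (translate va a) (translate vb (rot_cw b))
     (translate vc (rot_ccw c))).
have J : construction1 (0, 0) a b c (DNode (0, 0) (translate va a)
    (translate vb (rot_cw b)) (translate vc (rot_ccw c))).
  have Ba' := box_translate va Ba; have Bb' := box_translate vb (box_rot_cw Bb).
  have Bc' := box_translate vc (box_rot_ccw Bc).
  exists va, vb, vc => /=.
  rewrite (box_topmost Ba') (box_rightmost Bb') (box_leftmost Bc').
  rewrite (box_leftmost Ba') (box_rightmost Ba') !root_map ra rb rc /=.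
  by split=> //; lia.
split=> //; first exact: D12_cons1 J.
  exact: nodes_join.
move: (box_construction1 Ba Bb Bc J); rewrite /join1 /lft /rgt /ver /upw /=.
by congr box; lia.
Qed.

Lemma sound_join2 h A B C :
  sound h A -> sound h B -> sound h C -> sound h.+1 (join2 A B C).
Proof.
move=> [a [a12 ra na Ba]] [b [b12 rb nb Bb]] [c [c12 rc nc Bc]].
(* The maximum is the distance from the root down to the lowest row of the two rotated parts. *)
pose va := (0, - (Num.max (rgt B) (lft C) + 1 + upw A)) : point.
pose vb := (- (1 + upw B), 0) : point; pose vc := (1 + upw C, 0) : point.
exists (DNode (0, 0) (translate va a) (translate vb (rot_cw b))
     (translate vc (rot_ccw c))).
have J : construction2 (0, 0) a b c (DNode (0, 0) (translate va a)
    (translate vb (rot_cw b)) (translate vc (rot_ccw c))).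
  have Ba' := box_translate va Ba; have Bb' := box_translate vb (box_rot_cw Bb).
  have Bc' := box_translate vc (box_rot_ccw Bc).
  exists va, vb, vc => /=.
  rewrite (box_topmost Ba') (box_rightmost Bb') (box_leftmost Bc').
  rewrite (box_lowest Bb') (box_lowest Bc') !root_map ra rb rc /=.
  by split=> //; lia.
split=> //; first exact: D12_cons2 J.
  exact: nodes_join.
move: (box_construction2 Ba Bb Bc J); rewrite /join2 /lft /rgt /ver /upw /=.
by congr box; lia.
Qed.

Lemma level_sound h R : (0 < h)%N -> R \in level h -> sound h R.
Proof.
elim: h R => // -[_ R _|h IH R _].
  rewrite inE => /eqP ->; exists (DLeaf (0, 0)).
  by split=> //; [exact: D12_leaf|exact: box_leaf].
rewrite levelS // => /foldl_add_sub /= /mem_joinsP[A [B [C [/IH a /IH b /IH c]]]].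
by case=> ->; [apply: sound_join1|apply: sound_join2]; auto.
Qed.

(** The representative [R] may split its height at the root differently from [D]; hence [u] and [d]
    are existential and only their sum is prescribed. This is enough for the induction, because the
    keys of the joins ignore the split. *)
Lemma level_complete h D : drawing12 h D -> exists2 R, R \in level h &
  exists u d, box D (lft R) (rgt R) u d /\ ver R = u + d.
Proof.
(* The join itself may have been discarded, but a record with its key was kept. *)
have key_next h' R : (0 < h')%N -> R \in joins (level h') ->
    exists2 R', R' \in level h'.+1 & key R' = key R.
  move=> h'0 RJ; have /mapP[R' R'n ->] : key R \in map key (level h'.+1).
    by rewrite levelS // foldl_add_key; exact: map_f.
  by exists R'.
have pos h' D' : drawing12 h' D' -> (0 < h')%N by case.
elim=> {h D} [p|h r a b c D a12 IHa b12 IHb c12 IHc J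
  |h r a b c D a12 IHa b12 IHb c12 IHc J].
- by exists leaf_record; rewrite ?mem_head //; exists 0, 0; split=> //; exact: box_leaf.
- have [A Al [ua [da [Ba vA]]]] := IHa; have [B Bl [ub [db [Bb vB]]]] := IHb.
  have [C Cl [uc [dc [Bc vC]]]] := IHc.
  have [|R Rn Rk] := key_next h (join1 A B C) (pos _ _ a12).
    by apply/mem_joinsP; exists A, B, C; split=> //; left.
  exists R => //; rewrite /lft /rgt /ver -/(key R) Rk /=.
  by do 2 eexists; split; [rewrite vB vC; exact: box_construction1 Ba Bb Bc J|lia].
- have [A Al [ua [da [Ba vA]]]] := IHa; have [B Bl [ub [db [Bb vB]]]] := IHb.
  have [C Cl [uc [dc [Bc vC]]]] := IHc.
  have [|R Rn Rk] := key_next h (join2 A B C) (pos _ _ a12).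
    by apply/mem_joinsP; exists A, B, C; split=> //; right.
  exists R => //; rewrite /lft /rgt /ver -/(key R) Rk /=.
  by do 2 eexists; split; [rewrite vB vC; exact: box_construction2 Ba Bb Bc J|lia].
Qed.

(** * Number of representatives and minimality *)

Definition small (n : nat) (R : record) : bool :=
  [&& 0 <= lft R, 0 <= rgt R, 0 <= ver R, lft R + rgt R < n%:Z, ver R < n%:Z
    & size (pts R) == n].

(** In terms of grid lines, [small] allows at most [n] columns and [n] rows. Construction 1 adds up
    the columns of [a] and the rows of [b] and [c], at most [3 * n] in total; the remaining cases
    are bounded similarly. *)
Lemma joins_small n prev : {in prev, forall R, small n R} ->
  {in joins prev, forall R, small (3 * n + 1) R}.
Proof.
move=> sp R /mem_joinsP[A [B [C [/sp + /sp + /sp + H]]]].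
rewrite /small; case: H => ->; rewrite /join1 /join2 /pts /= !size_cat !size_map;
  rewrite /lft /rgt /ver /pts /=; lia.
Qed.

Lemma level_small h : (0 < h)%N -> {in level h, forall R, small (num_nodes h) R}.
Proof.
elim: h => // -[_ _ R|h IH _ R]; first by rewrite inE => /eqP ->.
rewrite levelS // num_nodesS => /foldl_add_sub; exact: joins_small (IH isT) R.
Qed.

(** The entries of a key are nonnegative and below [n], so absolute values map the keys injectively
    into a cube of side [n]. *)
Lemma size_small n (s : seq record) : uniq (map key s) ->
  {in s, forall R, small n R} -> (size s <= n ^ 3)%N.
Proof.
move=> us sn; pose f (k : int * int * int) := (`|k.1.1|%N, `|k.1.2|%N, `|k.2|%N).
have uf : uniq (map f (map key s)).
  rewrite map_inj_in_uniq // => _ _ /mapP[R /sn Rn ->] /mapP[R' /sn Rn' ->].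
  case: R R' Rn Rn' => [[[[l r] v] u] ps] [[[[l' r'] v'] u'] ps'].
  rewrite /small /f /key /lft /rgt /ver /= => ? ? [? ? ?].
  by congr (_, _, _); lia.
pose t := [seq (x, z) | x <- [seq (x, y) | x <- iota 0 n, y <- iota 0 n],
                        z <- iota 0 n].
have : {subset map f (map key s) <= t}.
  move=> _ /mapP[_ /mapP[R /sn Rn ->] ->]; rewrite /t.
  case: R Rn => [[[[l r] v] u] ps]; rewrite /small /lft /rgt /ver /= => Rn.
  have H : (`|l| < n)%N && (`|r| < n)%N && (`|v| < n)%N by lia.
  case/andP: H => /andP[ln rn] vn; apply/allpairsP; exists (`|l|%N, `|r|%N, `|v|%N).
  by split; rewrite ?mem_iota //=; apply/allpairsP; exists (`|l|%N, `|r|%N);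
    rewrite !mem_iota.
move/(uniq_leq_size uf); rewrite /t !size_allpairs !size_iota !size_map.
by rewrite expnS expnS expn1 mulnA.
Qed.

Lemma level_uniq h : uniq (map key (level h)).
Proof. by case: h => [|[|h]] //=; rewrite foldl_add_uniq. Qed.

Lemma level_neq0 h : (0 < h)%N -> level h != [::].
Proof.
elim: h => // -[_ _|h IH _] //; rewrite levelS //.
case: (level h.+1) (IH isT) => // A s _.
have : key (join1 A A A) \in map key (next_level (A :: s)).
  rewrite foldl_add_key; apply/map_f/mem_joinsP; exists A, A, A.
  by rewrite mem_head; split=> //; left.
by case: next_level.
Qed.

Definition rec_area (R : record) : int := (lft R + rgt R + 1) * (ver R + 1).

(** The area depends on the key only. Soundness realizes the minimum, and completeness gives any
    competitor the area of some record of the level. *)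
Lemma level_min h R : (0 < h)%N -> R \in level h ->
  {in level h, forall R', rec_area R <= rec_area R'} ->
  exists2 D, min_area_drawing12 h D & encode D = flat (pts R).
Proof.
move=> h0 Rl Rmin; have [D [D12 _ nD BD]] := level_sound h0 Rl.
exists D; last by rewrite encodeE nD.
split=> // D' /level_complete [R' R'l [u [d [BD' vR']]]].
move: (Rmin _ R'l); rewrite -lez_nat (box_area BD) (box_area BD') /rec_area vR'.
by move=> H; apply: le_trans H; rewrite le_eqVlt; apply/orP; left; apply/eqP; ring.
Qed.

(** * Total correctness with time bounds *)

(* Variable [k] of a program is the cell of address -k-1, which is [Negz k]; the
   cells of nonnegative address hold the lists of records. *)
Notation var k := (Read (Const (Negz k))).
Notation set k e := (Write (Const (Negz k)) e).
Notation fld k j := (Read (Add (Read (Const (Negz k))) (Const (Posz j)))).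

Definition wp (P : program) (T : nat) (m : memory) (Q : memory -> Prop) : Prop :=
  exists t m', [/\ exec P m t m', (t <= T)%N & Q m'].

Lemma wp_mono P T m (Q Q' : memory -> Prop) :
  wp P T m Q -> (forall m', Q m' -> Q' m') -> wp P T m Q'.
Proof. by move=> [t [m' [e tT q]]] QQ'; exists t, m'; split=> //; apply: QQ'. Qed.

Lemma wp_time T P T' m Q : wp P T m Q -> (T <= T')%N -> wp P T' m Q.
Proof. by move=> [t [m' [e tT q]]] TT'; exists t, m'; split=> //; lia. Qed.

Lemma wp_seq Q T1 T2 P R T m Q' :
  wp P T1 m Q -> (forall m', Q m' -> wp R T2 m' Q') -> (T1 + T2 <= T)%N ->
  wp (Seq P R) T m Q'.
Proof.
move=> [t1 [m1 [e1 tT1 q]]] /(_ _ q) [t2 [m2 [e2 tT2 q']]] TT.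
by exists (t1 + t2)%N, m2; split; [apply: exec_seq e1 e2|lia|].
Qed.

(** The number [n] of passes is fixed beforehand and the invariant is indexed by the passes done,
    which gives termination and the time bound together. *)
Lemma wp_while e body n T Tall m (Inv : nat -> memory -> Prop) :
  Inv 0%N m ->
  (forall j m', (j < n)%N -> Inv j m' ->
     0 < eval m' e /\ wp body T m' (Inv j.+1)) ->
  (forall m', Inv n m' -> eval m' e <= 0) ->
  (n * (eval_cost e + T + 1) + eval_cost e + 1 <= Tall)%N ->
  wp (WhilePos e body) Tall m (Inv n).
Proof.
move=> I0 Hb He TT.
suff /(_ n 0%N m (addn0 n) I0) H : forall d j m', (d + j)%N = n -> Inv j m' ->
    wp (WhilePos e body) (d * (eval_cost e + T + 1) + eval_cost e + 1) m' (Inv n).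
  exact: wp_time H TT.
elim=> [|d IH] j m' djn Ij.
  rewrite add0n in djn; rewrite djn in Ij.
  exists (eval_cost e).+1, m'; split=> //; last by lia.
  by apply: exec_while_false; apply: He.
have [|pos [t1 [m1 [e1 tT1 I1]]]] := Hb j m' _ Ij; first by lia.
have [|t2 [m2 [e2 tT2 I2]]] := IH j.+1 m1 _ I1; first by lia.
exists (eval_cost e + t1 + t2).+1, m2; split=> //; last by lia.
exact: exec_while_true e1 e2.
Qed.

(** * Loop-free programs and memory updates *)

Fixpoint loopfree (P : program) : bool :=
  match P with
  | Skip | Write _ _ => true
  | Seq P1 P2 | IfPos _ P1 P2 => loopfree P1 && loopfree P2
  | WhilePos _ _ => false
  end.

(** The value on [WhilePos] is a dummy, excluded by [loopfree] in [wp_run]. *)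
Fixpoint run (P : program) (m : memory) : memory :=
  match P with
  | Skip | WhilePos _ _ => m
  | Write e1 e2 => update m (eval m e1) (eval m e2)
  | Seq P1 P2 => run P2 (run P1 m)
  | IfPos e P1 P2 => if 0 < eval m e then run P1 m else run P2 m
  end.

Fixpoint run_cost (P : program) : nat :=
  match P with
  | Skip | WhilePos _ _ => 1
  | Write e1 e2 => (eval_cost e1 + eval_cost e2).+1
  | Seq P1 P2 => run_cost P1 + run_cost P2
  | IfPos e P1 P2 => (eval_cost e + (run_cost P1 + run_cost P2)).+1
  end%N.

Lemma wp_run P T m (Q : memory -> Prop) :
  loopfree P -> (run_cost P <= T)%N -> Q (run P m) -> wp P T m Q.
Proof.
move=> lP cT q; suff [t [e tP]] : exists t, exec P m t (run P m) /\ (t <= run_cost P)%N.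
  by exists t, (run P m); split=> //; lia.
elim: P {Q q T cT} m lP => [|e1 e2|P1 IH1 P2 IH2|e P1 IH1 P2 IH2|//] m /=.
- by exists 1%N; split=> //; apply: exec_skip.
- by move=> _; eexists; split; first exact: exec_write.
- case/andP=> /(IH1 m)[t1 [e1 l1]] /(IH2 (run P1 m))[t2 [e2 l2]].
  by exists (t1 + t2)%N; split; [apply: exec_seq e1 e2|lia].
- case/andP=> /(IH1 m)[t1 [e1 l1]] /(IH2 m)[t2 [e2 l2]].
  case: ifP => pos.
    by exists (eval_cost e + t1).+1; split; [exact: exec_if_true|lia].
  by exists (eval_cost e + t2).+1; split; [apply: exec_if_false => //|]; lia.
Qed.

Definition block (Ps : seq program) : program := foldr Seq Skip Ps.

(** The second branch rewrites the variable with its own value, so that both branches are an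
    [update] of the same cell and [run_setmax] is an equation between memories. *)
Definition setmax (k : nat) (e : expr) : program :=
  IfPos (Defs.Sub e (var k)) (set k e) (set k (var k)).

Lemma run_setmax k e m :
  run (setmax k e) m = update m (Negz k) (Num.max (m (Negz k)) (eval m e)).
Proof.
rewrite /=; case: ifP => H; congr update; lia.
Qed.

Lemma update_neg m k v k' :
  update m (Negz k) v (Negz k') = if k' == k then v else m (Negz k').
Proof. by []. Qed.

Lemma update_neg_pos m k v i : update m (Negz k) v (Posz i) = m (Posz i).
Proof. by []. Qed.

Lemma update_pos_neg m i v k : update m (Posz i) v (Negz k) = m (Negz k).
Proof. by []. Qed.

Lemma update_pos m i v j :
  update m (Posz i) v (Posz j) = if j == i then v else m (Posz j).
Proof. by []. Qed.

Definition updE := (update_neg, update_neg_pos, update_pos_neg, update_pos).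

(** Only variables are constrained; the cells of nonnegative address are tracked by [heap] or by
    separate equations. *)
Definition frame (X : seq nat) (m m' : memory) : Prop :=
  forall k, k \notin X -> m' (Negz k) = m (Negz k).

Lemma frame_refl X m : frame X m m.
Proof. by []. Qed.

Lemma frame_trans X m2 m1 m3 : frame X m1 m2 -> frame X m2 m3 -> frame X m1 m3.
Proof. by move=> F G k kX; rewrite G ?F. Qed.

Lemma frame_sub X Y m m' : frame X m m' -> all (mem Y) X -> frame Y m m'.
Proof. by move=> F /allP XY k kY; apply: F; apply: contra kY => /XY. Qed.

Notation vF := 0%N (only parsing).

(* The list [L] occupies the cells from [s] on, and the variable [vF] holds the
   address of the first cell after it. *)
Definition heap (s : nat) (L : seq int) (m : memory) : Prop :=
  (forall i, (i < size L)%N -> m (Posz (s + i)) = nth 0 L i)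
  /\ m (Negz vF) = Posz (s + size L).

Lemma heap_eq s L m m' : heap s L m -> (forall i, m' (Posz i) = m (Posz i)) ->
  m' (Negz vF) = m (Negz vF) -> heap s L m'.
Proof. by move=> [H F] E E'; split; [move=> i /H <-|rewrite E']. Qed.

Definition push (e : expr) : program :=
  Seq (Write (var vF) e) (set vF (Add (var vF) (Const (Posz 1)))).

Lemma wp_push s L m e : heap s L m ->
  wp (push e) (eval_cost e + 9) m (fun m' =>
    heap s (rcons L (eval m e)) m' /\ frame [:: vF] m m').
Proof.
move=> [H F]; apply: wp_run => //=; first by lia.
rewrite F; split; last first.
  by move=> k; rewrite inE !updE => /negbTE ->.
split; last by rewrite !updE F size_rcons /=; lia.
move=> i; rewrite size_rcons ltnS leq_eqVlt !updE nth_rcons => /orP[/eqP->|iL].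
  by rewrite ltnn !eqxx.
by rewrite iL eqn_add2l ltn_eqF // H.
Qed.

(** * Copying subdrawings *)

(* The records of the previous level fill the cells from [vS] to [vE], those of
   the level under construction the cells from [vE] to [vF]; [vW] and [vW'] are
   the lengths of a record of the two levels.  The records at [vA], [vB], [vC] are
   being combined into the one at [vG]: [vL], [vR], [vV], [vU] are its first four
   fields, and [vDA], [vDB], [vDC] the arguments of [move_a], [move_b],
   [move_c]. *)
Notation vS := 1%N (only parsing).
Notation vE := 2%N (only parsing).
Notation vW := 3%N (only parsing).
Notation vW' := 4%N (only parsing).
Notation vA := 5%N (only parsing).
Notation vB := 6%N (only parsing).
Notation vC := 7%N (only parsing).
Notation vK := 8%N (only parsing).
Notation vL := 9%N (only parsing).
Notation vR := 10%N (only parsing).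
Notation vV := 11%N (only parsing).
Notation vU := 12%N (only parsing).
Notation vDA := 13%N (only parsing).
Notation vDB := 14%N (only parsing).
Notation vDC := 15%N (only parsing).
Notation vSrc := 16%N (only parsing).
Notation vEnd := 17%N (only parsing).
Notation vX := 18%N (only parsing).
Notation vY := 19%N (only parsing).
Notation vG := 20%N (only parsing).
Notation vJ := 21%N (only parsing).
Notation vAcc := 22%N (only parsing).
Notation vCnt := 23%N (only parsing).
Notation vMin := 24%N (only parsing).
Notation vBest := 25%N (only parsing).

Notation num n := (Const (Posz n)).

Definition copy (e1 e2 : expr) : program :=
  WhilePos (Defs.Sub (var vEnd) (var vSrc))
    (Seq (block [:: set vX (Read (var vSrc)); set vY (fld vSrc 1);
                    set vSrc (Add (var vSrc) (num 2))])
       (Seq (push e1) (push e2))).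

(** The source lies inside the heap, at offset [o], and pushes only extend the heap, so the points
    still to be read stay intact. Both coordinates are saved in [vX] and [vY] before the first
    push. *)
Lemma wp_copy e1 e2 f s o L ps m :
  heap s L m -> (o + 2 * size ps <= size L)%N ->
  (forall i, (i < 2 * size ps)%N -> nth 0 L (o + i) = nth 0 (flat ps) i) ->
  m (Negz vSrc) = Posz (s + o) -> m (Negz vEnd) = Posz (s + o + 2 * size ps) ->
  (forall m', frame [:: vF; vSrc; vX; vY] m m' ->
     (eval m' e1, eval m' e2) = f (m' (Negz vX), m' (Negz vY))) ->
  (eval_cost e1 <= 9)%N -> (eval_cost e2 <= 9)%N ->
  wp (copy e1 e2) (100 * size ps + 100) m (fun m' =>
    heap s (L ++ flat (map f ps)) m' /\ frame [:: vF; vSrc; vX; vY] m m').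
Proof.
move=> Hm oL Lps mSrc mEnd ef c1 c2.
pose Inv j m' := [/\ heap s (L ++ flat (map f (take j ps))) m',
  frame [:: vF; vSrc; vX; vY] m m' & m' (Negz vSrc) = Posz (s + o + 2 * j)].
apply: (@wp_mono _ _ _ (Inv (size ps))); last first.
  by move=> m' []; rewrite take_size.
apply: (@wp_while _ _ _ 70 _ _ Inv).
- by rewrite /Inv take0 cats0 muln0 addn0.
- move=> j m1 jn [H1 F1 S1]; split.
    by rewrite /= S1 (F1 vEnd) // mEnd; lia.
  have [x [y Exy]] : exists x y, nth (0, 0) ps j = (x, y).
    by case: (nth _ _ _) => x y; exists x, y.
  have nth_flat qs i b : (i < size qs)%N -> (b < 2)%N ->
      nth 0 (flat qs) (2 * i + b) =
        if b == 0%N then (nth (0, 0) qs i).1 else (nth (0, 0) qs i).2.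
    move=> iq b2; elim: qs i iq => // q qs IH [_|i iq].
      by case: b b2 {IH} => [|[|]].
    by rewrite mulnS /= -IH.
  have rd b : (b < 2)%N -> m1 (Posz (s + o + 2 * j + b)) = if b == 0%N then x else y.
    move=> b2; case: H1 => H1 _.
    have jb : (2 * j + b < 2 * size ps)%N by lia.
    have ojL : (o + (2 * j + b) < size L)%N by apply: leq_trans oL; rewrite ltn_add2l.
    rewrite -addnA -addnA H1; last by rewrite size_cat ltn_addr.
    by rewrite nth_cat ojL Lps // nth_flat // Exy.
  apply: (@wp_seq (fun m2 => [/\ heap s (L ++ flat (map f (take j ps))) m2,
     frame [:: vF; vSrc; vX; vY] m m2, m2 (Negz vSrc) = Posz (s + o + 2 * j.+1),
     m2 (Negz vX) = x & m2 (Negz vY) = y]) 20 50) => //.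
    apply: wp_run => //=; split.
    + by apply: heap_eq H1 _ _.
    + apply: frame_trans F1 _ => k.
      by rewrite !inE !updE !negb_or => /and4P[_ /negbTE-> /negbTE-> /negbTE->].
    + by rewrite !updE /= S1; lia.
    + by rewrite !updE /= S1 -[(s + o + 2 * j)%N]addn0 rd.
    + by rewrite !updE /= S1 -PoszD updE rd.
  move=> m2 [H2 F2 S2 X2 Y2].
  have P2 := wp_time (wp_push e1 H2) (leq_add c1 (leqnn 9)).
  apply: (wp_seq (T2 := 18) P2) => //.
    move=> m3 [H3 F3]; have P3 := wp_time (wp_push e2 H3) (leq_add c2 (leqnn 9)).
    apply: wp_mono P3 _ => m4 [H4 F4].
    have F23 : frame [:: vF; vSrc; vX; vY] m m3.
      by apply: frame_trans F2 _; apply: frame_sub F3 _.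
    split.
    + have E1 : eval m2 e1 = (f (x, y)).1 by rewrite -X2 -Y2 -ef.
      have E2 : eval m3 e2 = (f (x, y)).2.
        by rewrite -X2 -Y2 -(F3 vX) // -(F3 vY) // -ef.
      move: H4; rewrite E2 E1 (take_nth (0, 0)) // Exy map_rcons.
      rewrite -[rcons (map _ _) _]cats1 flat_cat.
      by rewrite -!cats1 -!catA.
    + by apply: frame_trans F23 _; apply: frame_sub F4 _.
    + by rewrite F4 // F3 // S2.
- by move=> m1 [_ F1 S1]; rewrite /= S1 (F1 vEnd) // mEnd; lia.
- by move=> /=; lia.
Qed.

Ltac by_frame :=
  match goal with H : frame _ ?m ?m' |- frame _ ?m ?m' =>
    refine (frame_sub H _); vm_compute; reflexivity
  end.

(** * Layout of records in memory *)

Definition ser (R : record) : seq int :=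
  [:: lft R; rgt R; ver R; upw R] ++ flat (pts R).

Definition sers (rs : seq record) : seq int := flatten (map ser rs).

Definition ser_size (n : nat) : nat := (4 + 2 * n)%N.

Definition uniform (n : nat) (rs : seq record) : Prop :=
  {in rs, forall R, size (pts R) = n}.

Lemma size_ser R : size (ser R) = ser_size (size (pts R)).
Proof. by rewrite size_cat size_flat. Qed.

Lemma sers_rcons rs R : sers (rcons rs R) = sers rs ++ ser R.
Proof. by rewrite /sers map_rcons flatten_rcons. Qed.

Lemma sers_cons R rs : sers (R :: rs) = ser R ++ sers rs.
Proof. by []. Qed.

Lemma uniform_cons n R rs : uniform n (R :: rs) -> size (pts R) = n /\ uniform n rs.
Proof.
by move=> H; split=> [|x xs]; apply: H; rewrite inE ?eqxx ?xs ?orbT.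
Qed.

Lemma size_sers n rs : uniform n rs -> size (sers rs) = (size rs * ser_size n)%N.
Proof.
elim: rs => // R rs IH /uniform_cons[Rn rsn].
by rewrite sers_cons size_cat size_ser Rn IH // mulSn.
Qed.

(** Records of one level have equal length, so addresses are computed by arithmetic. The tail [X]
    stands for whatever is stored behind them. *)
Lemma nth_sers n rs X i j : uniform n rs -> (i < size rs)%N -> (j < ser_size n)%N ->
  nth 0 (sers rs ++ X) (i * ser_size n + j) = nth 0 (ser (nth leaf_record rs i)) j.
Proof.
elim: rs i => // R rs IH i /uniform_cons[Rn rsn] irs jn.
rewrite sers_cons -catA nth_cat size_ser Rn.
case: i irs => [|i] irs; first by rewrite jn.
by rewrite mulSn -addnA ltnNge leq_addr addKn IH.
Qed.

(** Each push changes [vF] and a heap cell, so the values must be stable under [frame [:: vF]],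
    which leaves the heap cells arbitrary. *)
Lemma wp_pushes es vs s L m : heap s L m ->
  (forall m', frame [:: vF] m m' -> map (eval m') es = vs) ->
  all (fun e => eval_cost e <= 9)%N es ->
  wp (block (map push es)) (18 * size es + 1) m (fun m' =>
    heap s (L ++ vs) m' /\ frame [:: vF] m m').
Proof.
elim: es vs L m => [|e es IH] vs L m HL He /=.
  by move=> _; apply: wp_run => //=; rewrite -(He m) // cats0.
case/andP=> ce ces; have P1 := wp_time (wp_push e HL) (leq_add ce (leqnn 9)).
have := He m (@frame_refl _ m); case: vs He => // v vs He [ev evs].
apply: (wp_seq (T2 := (18 * size es + 1)%N) P1); last by lia.
move=> m1 [H1 F1]; apply: wp_mono (IH vs _ _ H1 _ ces) _.
  by move=> m' F'; have [_ ->] := He m' (frame_trans F1 F').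
move=> m2; rewrite ev -cats1 -catA => -[H2 F2]; split=> //.
exact: frame_trans F1 F2.
Qed.

Definition copy_record (k : nat) (e1 e2 : expr) : program :=
  Seq (block [:: set vSrc (Add (var k) (num 4)); set vEnd (Add (var k) (var vW))])
    (copy e1 e2).

Lemma wp_copy_record k e1 e2 f s n rs X i m :
  heap s (sers rs ++ X) m -> uniform n rs -> (i < size rs)%N ->
  m (Negz k) = Posz (s + i * ser_size n) -> m (Negz vW) = Posz (ser_size n) ->
  k \notin [:: vSrc; vEnd] ->
  (forall m', frame [:: vF; vSrc; vEnd; vX; vY] m m' ->
     (eval m' e1, eval m' e2) = f (m' (Negz vX), m' (Negz vY))) ->
  (eval_cost e1 <= 9)%N -> (eval_cost e2 <= 9)%N ->
  wp (copy_record k e1 e2) (100 * n + 150) m (fun m' =>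
    heap s (sers rs ++ X ++ flat (map f (pts (nth leaf_record rs i)))) m'
    /\ frame [:: vF; vSrc; vEnd; vX; vY] m m').
Proof.
move=> Hm U irs mk mW kS ef c1 c2.
have szA : size (pts (nth leaf_record rs i)) = n by apply: U; exact: mem_nth.
apply: (wp_seq (Q := fun m' => [/\ heap s (sers rs ++ X) m',
   frame [:: vSrc; vEnd] m m', m' (Negz vSrc) = Posz (s + (i * ser_size n + 4))
   & m' (Negz vEnd) = Posz (s + (i * ser_size n + 4) + 2 * n)])
   (T1 := 20) (T2 := (100 * n + 100)%N)); last by lia.
  apply: wp_run => //=; split.
  + exact: heap_eq Hm _ _.
  + by move=> v; rewrite !inE !updE !negb_or => /andP[/negbTE-> /negbTE->].
  + by rewrite !updE /= mk; lia.
  (* Variable [k] is read a second time after [vSrc] has been overwritten, so it must differ from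
     [vSrc]. *)
  + rewrite !updE /=; move: kS; rewrite !inE negb_or => /andP[/negbTE-> _].
    by rewrite mk mW /ser_size; lia.
move=> m1 [H1 F1 S1 E1]; rewrite catA -{1}szA.
apply: wp_mono (wp_copy (f := f) (ps := pts (nth leaf_record rs i)) H1 _ _ S1 _ _ c1 c2) _.
- rewrite szA size_cat (size_sers U).
  have : (i.+1 * ser_size n <= size rs * ser_size n)%N by rewrite leq_mul2r irs orbT.
  by rewrite mulSn /ser_size; lia.
- move=> j; rewrite szA => jn; have j4 : (4 + j < ser_size n)%N by rewrite /ser_size; lia.
  by rewrite -addnA (nth_sers _ U irs j4).
- by rewrite szA.
- move=> m' F'; apply: ef; apply: (frame_trans (m2 := m1)); by_frame.
- move=> m2 [H2 F2]; split=> //.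
  by apply: (frame_trans (m2 := m1)); by_frame.
Qed.

(** * Extents of a combined drawing *)

Definition at_record (k : nat) (R : record) (m : memory) : Prop :=
  exists a, m (Negz k) = Posz a /\ [/\ m (Posz a) = lft R, m (Posz (a + 1)) = rgt R,
    m (Posz (a + 2)) = ver R & m (Posz (a + 3)) = upw R].

Lemma heap_at_record s n rs X i k m :
  heap s (sers rs ++ X) m -> uniform n rs -> (i < size rs)%N ->
  m (Negz k) = Posz (s + i * ser_size n) -> at_record k (nth leaf_record rs i) m.
Proof.
move=> [H _] U irs mk; exists (s + i * ser_size n)%N; split=> //.
have rd j : (j < 4)%N ->
    m (Posz (s + i * ser_size n + j)) = nth 0 (ser (nth leaf_record rs i)) j.
  move=> j4; rewrite -addnA H ?(nth_sers _ U) //; first by rewrite /ser_size; lia.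
  rewrite size_cat (size_sers U).
  have : (i.+1 * ser_size n <= size rs * ser_size n)%N by rewrite leq_mul2r irs orbT.
  by rewrite mulSn /ser_size; lia.
by rewrite -[X in Posz X]addn0 !rd.
Qed.

Lemma wp_set k e v Ps T m Q : eval m e = v ->
  wp (block Ps) T (update m (Negz k) v) Q ->
  wp (block (set k e :: Ps)) (eval_cost e + 2 + T) m Q.
Proof.
move=> ev H; apply: (wp_seq (Q := eq (update m (Negz k) v))) (leqnn _) => [|m' <- //].
by apply: wp_run => //=; rewrite ?ev //; lia.
Qed.

Lemma wp_setmax k e v v0 Ps T m Q : eval m e = v -> m (Negz k) = v0 ->
  wp (block Ps) T (update m (Negz k) (Num.max v0 v)) Q ->
  wp (block (setmax k e :: Ps)) (2 * eval_cost e + 10 + T) m Q.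
Proof.
move=> ev ev0 H; apply: (wp_seq (Q := eq (update m (Negz k) (Num.max v0 v)))) (leqnn _)
  => [|m' <- //].
apply: wp_run => //; last by rewrite run_setmax ev ev0.
by rewrite /=; lia.
Qed.

Lemma frame_update X k v m m' :
  k \in X -> frame X m m' -> frame X m (update m' (Negz k) v).
Proof.
move=> kX F j jX; rewrite update_neg; case: eqP => [jk|_]; last exact: F.
by rewrite -jk (negbTE jX) in kX.
Qed.

(** [vV] first collects the downward extent and becomes the height when the upward extent [vU] is
    added. *)
Definition extents1 : program := block
  [:: set vU (fld vB 0); setmax vU (fld vC 1);
      set vV (Add (fld vA 2) (num 1)); setmax vV (fld vB 1); setmax vV (fld vC 0);
      set vV (Add (var vV) (var vU));
      set vL (Add (Add (fld vA 0) (num 1)) (fld vB 2));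
      set vR (Add (Add (fld vA 1) (num 1)) (fld vC 2));
      set vDA (Add (num 1) (fld vA 3));
      set vDB (Add (Add (fld vA 0) (num 1)) (fld vB 3));
      set vDC (Add (Add (fld vA 1) (num 1)) (fld vC 3))].

(** The intermediate value of [vV], one more than the depth reached by the rotated parts, also
    enters [vDA] before [vV] is completed. *)
Definition extents2 : program := block
  [:: set vU (fld vB 0); setmax vU (fld vC 1);
      set vV (fld vB 1); setmax vV (fld vC 0); set vV (Add (var vV) (num 1));
      set vDA (Add (var vV) (fld vA 3));
      set vV (Add (Add (var vV) (fld vA 2)) (var vU));
      set vL (Add (num 1) (fld vB 2)); setmax vL (fld vA 0);
      set vR (Add (num 1) (fld vC 2)); setmax vR (fld vA 1);
      set vDB (Add (num 1) (fld vB 3));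
      set vDC (Add (num 1) (fld vC 3))].

Definition extents_of (join : record -> record -> record -> record) A B C m m' : Prop :=
  [/\ [/\ m' (Negz vL) = lft (join A B C), m' (Negz vR) = rgt (join A B C),
          m' (Negz vV) = ver (join A B C) & m' (Negz vU) = upw (join A B C)],
      pts (join A B C) = join_pts (m' (Negz vDA)) (m' (Negz vDB)) (m' (Negz vDC)) A B C,
      frame (iota 9 7) m m' & forall i, m' (Posz i) = m (Posz i)].

Definition computes_extents (ext : program) join : Prop := forall A B C m,
  at_record vA A m -> at_record vB B m -> at_record vC C m ->
  wp ext 300 m (extents_of join A B C m).

Ltac eval_fields :=
  rewrite /= ?updE /=;
  repeat match goal with H : ?m (Negz _) = Posz _ |- _ => rewrite H end;
  rewrite -?PoszD ?addn0 ?updE;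
  repeat match goal with H : ?m (Posz _) = _ |- _ => rewrite H end;
  reflexivity.

(** Symbolic execution: each assignment becomes an [update] whose value is expressed by the fields
    of [A], [B], [C], and the final memory is compared with the join by computation. The time bound
    is an existential variable filled on the way. *)
Ltac solve_extents :=
  let A := fresh "A" in let B := fresh "B" in let C := fresh "C" in
  move=> A B C ? [? [? [? ? ? ?]]] [? [? [? ? ? ?]]] [? [? [? ? ? ?]]];
  apply: wp_time;
  [ repeat first
      [ apply: wp_set; [eval_fields|]
      | apply: wp_setmax; [eval_fields|eval_fields|] ];
    apply: (@wp_run Skip 1) => //;
    split; [by []|by []| |by []];
    repeat (apply: frame_update; first by []); exact: frame_refl
  | by [] ].

Lemma extents1_correct : computes_extents extents1 join1.
Proof. solve_extents. Qed.

Lemma extents2_correct : computes_extents extents2 join2.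
Proof. solve_extents. Qed.

(** * Discarding duplicates *)

Definition if_eq (e1 e2 : expr) (P : program) : program :=
  IfPos (Defs.Sub e1 e2) Skip (IfPos (Defs.Sub e2 e1) Skip P).

Lemma run_if_eq e1 e2 P m :
  run (if_eq e1 e2 P) m = if eval m e1 == eval m e2 then run P m else m.
Proof.
by rewrite /= !subr_gt0; case: ltgtP.
Qed.

(* Moving [vF] back to [vG] discards the new record. *)
Definition dedup_body : program := Seq
  (if_eq (fld vJ 0) (var vL) (if_eq (fld vJ 1) (var vR) (if_eq (fld vJ 2) (var vV)
     (set vF (var vG)))))
  (set vJ (Add (var vJ) (var vW'))).

Definition dedup : program := Seq (set vJ (var vE))
  (WhilePos (Defs.Sub (var vG) (var vJ)) dedup_body).

(** No heap cell is written: the new record is kept or dropped by the value of [vF] alone. The guard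
    compares [vJ] with [vG] rather than [vF], so the scan makes [size rs] passes even after a
    match. *)
Lemma wp_dedup s L n rs R m :
  heap s (L ++ sers rs ++ ser R) m -> uniform n rs -> size (pts R) = n ->
  m (Negz vE) = Posz (s + size L) -> m (Negz vW') = Posz (ser_size n) ->
  m (Negz vG) = Posz (s + size L + size rs * ser_size n) ->
  m (Negz vL) = lft R -> m (Negz vR) = rgt R -> m (Negz vV) = ver R ->
  wp dedup (200 * size rs + 100) m (fun m' =>
    heap s (L ++ sers (add_record rs R)) m' /\ frame [:: vF; vJ] m m').
Proof.
move=> Hm U Rn mE mW mG mL mR mV.
pose Inv j m' := [/\ (forall i, m' (Posz i) = m (Posz i)), frame [:: vF; vJ] m m',
  m' (Negz vJ) = Posz (s + size L + j * ser_size n)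
  & m' (Negz vF) = Posz (s + size L + size rs * ser_size n +
      if key R \in map key (take j rs) then 0 else ser_size n)].
have F0 : m (Negz vF) = Posz (s + size L + size rs * ser_size n + ser_size n).
  case: Hm => _ ->; rewrite size_cat size_cat (size_sers U) size_ser Rn; congr Posz; lia.
apply: (@wp_seq (Inv 0%N) 10 (200 * size rs + 50)); last by lia.
  apply: wp_run => //; split=> //=.
  - by move=> k; rewrite !inE !updE negb_or => /andP[_ /negbTE ->].
  - by rewrite !updE /= mE mul0n addn0.
  - by rewrite !updE /= take0.
move=> m0 I0; apply: (@wp_mono _ _ _ (Inv (size rs))); last first.
  move=> m' [Hc F _ vf]; split=> //; move: vf; rewrite take_size /add_record.
  case: Hm => Hm _; case: ifP => kR vf; split=> [i iL|]; rewrite ?Hc ?vf.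
  - rewrite Hm; last by rewrite catA size_cat ltn_addr.
    by rewrite catA nth_cat iL.
  - by rewrite size_cat (size_sers U); congr Posz; lia.
  - by rewrite sers_rcons Hm // -sers_rcons.
  - by rewrite sers_rcons size_cat size_cat (size_sers U) size_ser Rn; congr Posz; lia.
apply: (@wp_while _ _ _ 90 _ _ Inv) => //.
- move=> j m1 jn [Hc F J1 V1]; split.
    rewrite /= J1 (F vG) // mG.
    have : (j.+1 * ser_size n <= size rs * ser_size n)%N by rewrite leq_mul2r jn orbT.
    by rewrite mulSn {1}/ser_size; lia.
  have [a [ja [f0 f1 f2 f3]]] : at_record vJ (nth leaf_record rs j) m1.
    exists (s + size L + j * ser_size n)%N; split=> //; rewrite !Hc.
    have rd i : (i < 4)%N -> m (Posz (s + size L + j * ser_size n + i)) =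
        nth 0 (ser (nth leaf_record rs j)) i.
      move=> i4; have ii : (i < ser_size n)%N by rewrite /ser_size; lia.
      have nE := nth_sers (ser R) U jn ii; case: Hm => Hm _.
      rewrite -addnA -addnA Hm; first by rewrite nth_cat ltnNge leq_addr addKn nE.
      rewrite size_cat size_cat ltn_add2l ltn_addr // (size_sers U).
      have : (j.+1 * ser_size n <= size rs * ser_size n)%N by rewrite leq_mul2r jn orbT.
      by rewrite mulSn; lia.
    by rewrite -[X in Posz X]addn0 !rd.
  set R' := nth leaf_record rs j in f0 f1 f2 f3.
  have E1 : key R \in map key (take j.+1 rs) =
      (key R == key R') || (key R \in map key (take j rs)).
    by rewrite (take_nth leaf_record) // map_rcons mem_rcons inE.
  have E2 : (key R == key R') = [&& lft R' == lft R, rgt R' == rgt R & ver R' == ver R].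
    case: (R) (R') => [[[[l r] v] u] ps] [[[[l' r'] v'] u'] ps'].
    by rewrite /key /lft /rgt /ver /= !xpair_eqE andbA !(eq_sym l) !(eq_sym r) (eq_sym v).
  have rL : m1 (Negz vL) = lft R by rewrite F.
  have rR : m1 (Negz vR) = rgt R by rewrite F.
  have rV : m1 (Negz vV) = ver R by rewrite F.
  have rW : m1 (Negz vW') = Posz (ser_size n) by rewrite F.
  have rG : m1 (Negz vG) = Posz (s + size L + size rs * ser_size n) by rewrite F.
  apply: (@wp_seq (fun m2 => [/\ (forall i, m2 (Posz i) = m (Posz i)),
     frame [:: vF; vJ] m m2, m2 (Negz vJ) = Posz (s + size L + j * ser_size n) &
     m2 (Negz vF) = Posz (s + size L + size rs * ser_size n +
      if key R \in map key (take j.+1 rs) then 0 else ser_size n)]) 80 10) => //.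
    apply: wp_run => //.
    rewrite !run_if_eq; cbn [run eval]; rewrite ja -!PoszD addn0 f0 f1 f2 rL rR rV rG.
    rewrite E1 E2; do 3 case: eqP => //= _.
    split=> //; last by rewrite !updE addn0.
    by apply: frame_update.
  move=> m2 [Hc2 F2 J2 V2]; apply: wp_run => //=; split=> //.
  - by apply: frame_update.
  - by rewrite !updE /= J2 (F2 vW') // mW -PoszD; congr Posz; lia.
- move=> m1 [Hc F J1 V1]; rewrite /= J1 (F vG) // mG; lia.
- by move=> /=; lia.
Qed.

(** * Computing the levels *)

Notation temporaries :=
  [:: vF; vL; vR; vV; vU; vDA; vDB; vDC; vSrc; vEnd; vX; vY; vG; vJ] (only parsing).

(** The two zeros pushed after the four header fields are the coordinates of the root, the first
    node in preorder. *)
Definition candidate (ext : program) : program :=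
  Seq ext (Seq (set vG (var vF)) (Seq
    (block (map push [:: var vL; var vR; var vV; var vU; num 0; num 0]))
  (Seq (copy_record vA (var vX) (Defs.Sub (var vY) (var vDA)))
  (Seq (copy_record vB (Defs.Sub (var vY) (var vDB)) (Defs.Sub (num 0) (var vX)))
  (Seq (copy_record vC (Defs.Sub (var vDC) (var vY)) (var vX)) dedup))))).

(* [prev] is stored from address [s] on, followed by [cur]. *)
Definition levels_at (s n : nat) (prev cur : seq record) (m : memory) : Prop :=
  [/\ heap s (sers prev ++ sers cur) m, m (Negz vS) = Posz s,
      m (Negz vE) = Posz (s + size prev * ser_size n), m (Negz vW) = Posz (ser_size n)
    & m (Negz vW') = Posz (ser_size (3 * n + 1))].

Lemma wp_candidate ext join s n prev cur m i j k :
  computes_extents ext join ->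
  levels_at s n prev cur m -> uniform n prev -> uniform (3 * n + 1) cur ->
  (i < size prev)%N -> (j < size prev)%N -> (k < size prev)%N ->
  m (Negz vA) = Posz (s + i * ser_size n) ->
  m (Negz vB) = Posz (s + j * ser_size n) ->
  m (Negz vC) = Posz (s + k * ser_size n) ->
  wp (candidate ext) (300 * n + 200 * size cur + 2000) m (fun m' =>
    levels_at s n prev (add_record cur (join (nth leaf_record prev i)
      (nth leaf_record prev j) (nth leaf_record prev k))) m'
    /\ frame temporaries m m').
Proof.
move=> Hext [Hm mS mE mW mW'] U U' ip jp kp mA mB mC.
set A := nth _ _ i; set B := nth _ _ j; set C := nth _ _ k; set R := join A B C.
have atA := heap_at_record Hm U ip mA.
have atB := heap_at_record Hm U jp mB.
have atC := heap_at_record Hm U kp mC.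
apply: (wp_seq (T2 := (300 * n + 200 * size cur + 1700)%N) (Hext A B C m atA atB atC));
  last by lia.
move=> m1 [[L1 R1 V1 U1] P1 F1 H1].
have {H1} Hm1 : heap s (sers prev ++ sers cur) m1 by apply: heap_eq Hm _ _; rewrite ?F1.
have {}F1 : frame temporaries m m1 by by_frame.
move: P1; move Eda: (m1 (Negz vDA)) => da; move Edb: (m1 (Negz vDB)) => db.
move Edc: (m1 (Negz vDC)) => dc P1.
pose io := [:: vF; vSrc; vEnd; vX; vY].
have szR : size (pts R) = (3 * n + 1)%N.
  by rewrite P1 /= !size_cat !size_map !U ?mem_nth //; lia.
apply: (@wp_seq (fun m2 => [/\ heap s (sers prev ++ sers cur) m2, frame [:: vG] m1 m2
    & m2 (Negz vG) = Posz (s + size prev * ser_size n + size cur * ser_size (3 * n + 1))])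
    10 (300 * n + 200 * size cur + 1600)); last by lia.
  apply: wp_run => //=; split.
  - exact: heap_eq Hm1 _ _.
  - by apply: frame_update.
  - rewrite updE /=; case: Hm1 => _ ->.
    by rewrite size_cat (size_sers U) (size_sers U') addnA.
move=> m2 [H2 F2 G2].
apply: (wp_seq (T2 := (300 * n + 200 * size cur + 1400)%N)
  (wp_pushes (vs := [:: lft R; rgt R; ver R; upw R; 0; 0]) H2 _ _)) => //=; last by lia.
  by move=> m' F'; rewrite !F' // !F2 // L1 R1 V1 U1.
move=> m3 []; rewrite -catA => H3 {}F'.
have {F'} F3 : frame io m2 m3 by by_frame.
have toF m' : frame io m2 m' -> frame temporaries m m'.
  move=> F; apply: (frame_trans F1); apply: (@frame_trans _ m2); by_frame.
apply: (wp_seq (T2 := (200 * n + 200 * size cur + 1200)%N)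
  (wp_copy_record (f := move_a da) H3 U ip _ _ _ _ _ _)) => //; last by lia.
- by rewrite (toF _ F3).
- by rewrite (toF _ F3).
- by move=> m' F' /=; rewrite (F' vDA) // F3 // F2 // Eda.
move=> m4 [H4 F']; have {F'} F4 : frame io m2 m4 by exact: frame_trans F3 F'.
apply: (wp_seq (T2 := (100 * n + 200 * size cur + 1000)%N)
  (wp_copy_record (f := move_b db) H4 U jp _ _ _ _ _ _)) => //; last by lia.
- by rewrite (toF _ F4).
- by rewrite (toF _ F4).
- by move=> m' F' /=; rewrite (F' vDB) // F4 // F2 // Edb sub0r.
move=> m5 [H5 F']; have {F'} F5 : frame io m2 m5 by exact: frame_trans F4 F'.
apply: (wp_seq (T2 := (200 * size cur + 800)%N)
  (wp_copy_record (f := move_c dc) H5 U kp _ _ _ _ _ _)) => //; last by lia.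
- by rewrite (toF _ F5).
- by rewrite (toF _ F5).
- by move=> m' F' /=; rewrite (F' vDC) // F5 // F2 // Edc.
move=> m6 [H6 F']; have {F'} F6 : frame io m2 m6 by exact: frame_trans F5 F'.
have {}H6 : heap s (sers prev ++ sers cur ++ ser R) m6.
  have fR : flat (pts R) = [:: 0; 0] ++ flat (map (move_a da) (pts A)) ++
      flat (map (move_b db) (pts B)) ++ flat (map (move_c dc) (pts C)).
    by rewrite [pts R]P1 -!flat_cat.
  by move: H6; rewrite /ser fR -!catA.
apply: wp_time (_ : 200 * size cur + 100 <= _)%N; last by lia.
apply: wp_mono (wp_dedup H6 U' szR _ _ _ _ _ _) _.
- by rewrite (toF _ F6) // mE (size_sers U).
- by rewrite (toF _ F6).
- by rewrite F6 // G2 (size_sers U).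
- by rewrite F6 // F2 // L1.
- by rewrite F6 // F2 // R1.
- by rewrite F6 // F2 // V1.
move=> m7 [H7 F7].
have F07 : frame temporaries m m7 by apply: (frame_trans (toF _ F6)); by_frame.
by split=> //; split; rewrite // F07.
Qed.

Definition forall_records (k : nat) (body : program) : program :=
  Seq (set k (var vS)) (WhilePos (Defs.Sub (var vE) (var k))
    (Seq body (set k (Add (var k) (var vW))))).

(** Kept at every moment of the construction of a level, this bounds the unfinished list by
    [size_small], and with it the cost of every search for duplicates. *)
Definition admissible (n : nat) (rs : seq record) : Prop :=
  uniq (map key rs) /\ {in rs, forall R, small n R}.

Lemma small_uniform n rs : {in rs, forall R, small n R} -> uniform n rs.
Proof. by move=> H R /H /and5P[_ _ _ _ /andP[_ /eqP]]. Qed.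

Lemma admissible_add n rs R :
  admissible n rs -> small n R -> admissible n (add_record rs R).
Proof.
rewrite /add_record => -[u sm] sR; case: ifP => // kR; split.
  by rewrite map_rcons rcons_uniq kR.
by move=> x; rewrite mem_rcons inE => /orP[/eqP->|/sm].
Qed.

Lemma levels_at_update k v s n prev cur m : k \in [:: vA; vB; vC; vK] ->
  levels_at s n prev cur m -> levels_at s n prev cur (update m (Negz k) v).
Proof.
by rewrite !inE => /or4P[]/eqP-> [H S E W W']; split=> //; apply: heap_eq H _ _.
Qed.

(** The effect of the loop has the same form as that of its body, a [foldl add_record] over a list
    of joins, so the lemma can be nested. The body may rely on [frame (k :: X) m m'] to know that
    outer loop variables are unchanged. *)
Lemma wp_forall_records k body T N X s n prev g z m :
  k \in [:: vA; vB; vC] -> k \notin X -> (size prev <= N)%N ->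
  (forall i z' m', (i < size prev)%N -> admissible (3 * n + 1) z' ->
     levels_at s n prev z' m' -> frame (k :: X) m m' ->
     m' (Negz k) = Posz (s + i * ser_size n) ->
     wp body T m' (fun m2 => let z2 := foldl add_record z' (g (nth leaf_record prev i)) in
       [/\ admissible (3 * n + 1) z2, levels_at s n prev z2 m2 & frame X m' m2])) ->
  admissible (3 * n + 1) z -> levels_at s n prev z m ->
  wp (forall_records k body) (N * (T + 20) + 30) m (fun m2 =>
    let z2 := foldl add_record z (flatten (map g prev)) in
    [/\ admissible (3 * n + 1) z2, levels_at s n prev z2 m2 & frame (k :: X) m m2]).
Proof.
move=> kABC kX pN Hbody az Lz.
have kABCK : k \in [:: vA; vB; vC; vK].
  by move: kABC; rewrite !inE => /or3P[] ->; rewrite ?orbT.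
pose Z j := foldl add_record z (flatten (map g (take j prev))).
pose Inv j m' := [/\ admissible (3 * n + 1) (Z j), levels_at s n prev (Z j) m',
  frame (k :: X) m m' & m' (Negz k) = Posz (s + j * ser_size n)].
apply: (@wp_seq (Inv 0%N) 4 (N * (T + 20) + 20)); last by lia.
  apply: wp_run => //; rewrite /Inv /Z take0 /=; split=> //.
  - exact: levels_at_update.
  - by apply: frame_update; rewrite ?mem_head.
  - by rewrite updE eqxx; case: Lz => _ ->; rewrite mul0n addn0.
move=> m0 I0; apply: (@wp_mono _ _ _ (Inv (size prev))); last first.
  by move=> m'; rewrite /Inv /Z take_size => -[].
apply: (@wp_while _ _ _ (T + 10)%N _ _ Inv) => //.
- move=> j m1 jp [a1 L1 F1 k1]; split.
    case: L1 => _ _ E1 _ _; rewrite /= E1 k1.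
    have : (j.+1 * ser_size n <= size prev * ser_size n)%N by rewrite leq_mul2r jp orbT.
    by rewrite mulSn {1}/ser_size; lia.
  apply: (wp_seq (T2 := 10) (Hbody j _ m1 jp a1 L1 F1 k1)) => // m2 [].
  set z2 := foldl _ _ _; have -> : z2 = Z j.+1.
    by rewrite /Z (take_nth leaf_record) // map_rcons flatten_rcons foldl_cat.
  move=> a2 L2 F2; apply: wp_run => //=; split=> //.
  - exact: levels_at_update.
  - apply: frame_update; rewrite ?mem_head //; apply: frame_trans F1 _ => v.
    by rewrite inE negb_or => /andP[_ /F2].
  - by rewrite updE eqxx (F2 _ kX) k1; case: L2 => _ _ _ -> _; rewrite -PoszD; congr Posz; lia.
- by move=> m1 [_ L1 _ k1]; case: L1 => _ _ E1 _ _; rewrite /= E1 k1 subrr.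
- have : (size prev * (T + 16) <= N * (T + 20))%N by apply: leq_mul => //; lia.
  by rewrite /=; lia.
Qed.

(* [3 * ser_size n - 6 = ser_size (3 * n + 1)]. *)
Definition level_step : program :=
  Seq (block [:: set vE (var vF);
                 set vW' (Defs.Sub (Add (Add (var vW) (var vW)) (var vW)) (num 6))])
  (Seq (forall_records vA (forall_records vB (forall_records vC
         (Seq (candidate extents1) (candidate extents2)))))
    (block [:: set vS (var vE); set vW (var vW')])).

(** Here [N ^ 3] bounds the number of records of the level under construction, and in [loop_time]
    that of the previous level. *)
Definition candidate_time (N : nat) : nat := (300 * N + 200 * N ^ 3 + 2000)%N.
Definition loop_time (N T : nat) : nat := (N ^ 3 * (T + 20) + 30)%N.
Definition step_time (N : nat) : nat :=
  (loop_time N (loop_time N (loop_time N (2 * candidate_time N))) + 100)%N.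

Definition stored (s n : nat) (rs : seq record) (m : memory) : Prop :=
  [/\ heap s (sers rs) m, m (Negz vS) = Posz s & m (Negz vW) = Posz (ser_size n)].

(** The old level is left behind in memory and the new one starts where it ended, whence the new
    base address [s']. The counter [vK] of the outer loop must survive. *)
Lemma wp_level_step N s n prev m :
  admissible n prev -> (3 * n + 1 <= N)%N ->
  {in joins prev, forall R, small (3 * n + 1) R} -> stored s n prev m ->
  wp level_step (step_time N) m (fun m' =>
    (exists s', stored s' (3 * n + 1) (next_level prev) m') /\ m' (Negz vK) = m (Negz vK)).
Proof.
move=> [up sp] nN sj [Hm mS mW]; have U := small_uniform sp.
have pN : (size prev <= N ^ 3)%N.
  by apply: leq_trans (size_small up sp) _; rewrite leq_exp2r //; lia.
apply: (@wp_seq (fun m1 => levels_at s n prev [::] m1 /\ frame [:: vE; vW'] m m1)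
   30 (loop_time N (loop_time N (loop_time N (2 * candidate_time N))) + 30));
  last by rewrite /step_time; lia.
  apply: wp_run => //; split; last by do 2 (apply: frame_update; first by []).
  split=> //=; first by rewrite cats0; apply: heap_eq Hm _ _.
  - by rewrite !updE /=; case: Hm => _ ->; rewrite (size_sers U).
  - by rewrite !updE /= mW /ser_size; lia.
move=> m1 [L1 F1].
pose Y := temporaries.
apply: (@wp_seq (fun m2 => let z := next_level prev in
  [/\ admissible (3 * n + 1) z, levels_at s n prev z m2 & frame (vA :: vB :: vC :: Y) m1 m2])
   (loop_time N (loop_time N (loop_time N (2 * candidate_time N)))) 30) => //; last first.
  move=> m2 [_ [[H2 F2'] S2 E2 W2 W2'] F2]; apply: wp_run => //=; split; last first.
    by rewrite !updE /= F2 // F1.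
  exists (s + size prev * ser_size n)%N; split; rewrite ?updE //=.
  split; last by rewrite !updE /= F2' size_cat (size_sers U) addnA.
  move=> i iz; rewrite !updE -addnA H2.
    by rewrite nth_cat (size_sers U) ltnNge leq_addr addKn.
  by rewrite size_cat (size_sers U) ltn_add2l.
(* The three loops correspond to the three layers of [joins]; the innermost one contributes two
   candidates. *)
apply: (@wp_forall_records vA _ _ _ _ _ _ _ (fun A => joinsB A prev)) => //.
move=> ia za ma iap aza Lza Fa iA.
apply: (@wp_forall_records vB _ _ _ _ _ _ _
  (fun B => joinsC (nth leaf_record prev ia) B prev)) => //.
move=> ib zb mb ibp azb Lzb Fb iB.
apply: (@wp_forall_records vC _ _ _ _ _ _ _ (fun C =>
  [:: join1 (nth leaf_record prev ia) (nth leaf_record prev ib) C;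
      join2 (nth leaf_record prev ia) (nth leaf_record prev ib) C])) => //.
move=> ic zc mc icp azc Lzc Fc iC.
set A := nth leaf_record prev ia; set B := nth leaf_record prev ib.
set C := nth leaf_record prev ic.
have mcA : mc (Negz vA) = Posz (s + ia * ser_size n) by rewrite Fc // Fb.
have mcB : mc (Negz vB) = Posz (s + ib * ser_size n) by rewrite Fc.
have T z : admissible (3 * n + 1) z ->
    (300 * n + 200 * size z + 2000 <= candidate_time N)%N.
  move=> [uz sz]; have := size_small uz sz; rewrite /candidate_time => szz.
  have : ((3 * n + 1) ^ 3 <= N ^ 3)%N by rewrite leq_exp2r.
  by lia.
have small_join R : R = join1 A B C \/ R = join2 A B C -> small (3 * n + 1) R.
  move=> HR; have : R \in joins prev.
    by apply/mem_joinsP; do 3 eexists; split; last exact: HR; exact: mem_nth.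
  exact: sj.
have C1 := wp_candidate extents1_correct Lzc U (small_uniform azc.2) iap ibp icp mcA mcB iC.
apply: (wp_seq (T2 := candidate_time N) (wp_time C1 (T _ azc))); last by lia.
move=> m2 [L2 F2].
have az2 := admissible_add azc (small_join _ (or_introl erefl)).
have C2 := wp_candidate extents2_correct L2 U (small_uniform az2.2) iap ibp icp.
apply: wp_mono (wp_time (C2 _ _ _) (T _ az2)) _; rewrite ?F2 //.
move=> m3 [L3 F3]; split=> //.
  exact: admissible_add az2 (small_join _ (or_intror erefl)).
exact: frame_trans F2 F3.
Qed.

(** * Minimum, output and running time *)

(** The machine cannot multiply: the number of columns is added once per row. [small] keeps the
    number of rows at most [n]. *)
Definition area_loop : program :=
  Seq (block [:: set vAcc (num 0); set vCnt (Add (fld vJ 2) (num 1))])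
    (WhilePos (var vCnt)
      (block [:: set vAcc (Add (var vAcc) (Add (Add (fld vJ 0) (fld vJ 1)) (num 1)));
                 set vCnt (Defs.Sub (var vCnt) (num 1))])).

Lemma wp_area_loop n R m : at_record vJ R m -> small n R ->
  wp area_loop (60 * n + 60) m (fun m' => [/\ m' (Negz vAcc) = rec_area R,
    frame [:: vAcc; vCnt] m m' & forall i, m' (Posz i) = m (Posz i)]).
Proof.
move=> [a [mJ [a0 a1 a2 a3]]] /and5P[l0 r0 v0 _ /andP[vn _]].
pose Inv (j : nat) (m' : memory) := [/\ m' (Negz vAcc) = (lft R + rgt R + 1) * j%:Z,
  m' (Negz vCnt) = ver R + 1 - j%:Z, frame [:: vAcc; vCnt] m m'
  & forall i, m' (Posz i) = m (Posz i)].
apply: (@wp_seq (Inv 0%N) 20 (60 * n + 40)); last by lia.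
  apply: wp_run => //; split=> //=; last by do 2 (apply: frame_update; first by []).
  - by rewrite mulr0.
  - by rewrite !updE /= mJ -PoszD updE a2 subr0.
move=> m0 I0; have vE : Posz `|(ver R + 1)%R|%N = ver R + 1 by lia.
apply: (@wp_mono _ _ _ (Inv `|(ver R + 1)%R|%N)); last by move=> m' []; rewrite vE.
apply: (@wp_while _ _ _ 40 _ _ Inv) => //.
- move=> j m1 jv [A1 C1 F1 H1]; split; first by rewrite /= C1; lia.
  apply: wp_run => //; split=> //=.
  + by rewrite !updE /= (F1 vJ) // mJ -!PoszD addn0 !H1 a0 a1 A1 -addn1 PoszD; ring.
  + by rewrite !updE /= C1 -addn1 PoszD; ring.
  + by do 2 (apply: frame_update; first by []).
- by move=> m1 [_ C1 _ _]; rewrite /= C1; lia.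
- by rewrite /=; lia.
Qed.

(** Record 0 supplies the initial candidate and is examined again by the loop, which therefore
    starts with a vacuous minimality claim. *)
Definition minimum : program :=
  Seq (set vJ (var vS)) (Seq area_loop (Seq
    (block [:: set vMin (var vAcc); set vBest (var vJ)])
    (WhilePos (Defs.Sub (var vF) (var vJ)) (Seq area_loop (Seq
      (IfPos (Defs.Sub (var vMin) (var vAcc))
         (block [:: set vMin (var vAcc); set vBest (var vJ)]) Skip)
      (set vJ (Add (var vJ) (var vW)))))))).

Lemma wp_minimum s n rs m :
  stored s n rs m -> rs != [::] -> {in rs, forall R, small n R} ->
  wp minimum (size rs * (60 * n + 200) + 60 * n + 200) m (fun m' => exists b,
    [/\ (b < size rs)%N, m' (Negz vBest) = Posz (s + b * ser_size n),
        forall i, (i < size rs)%N ->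
          rec_area (nth leaf_record rs b) <= rec_area (nth leaf_record rs i)
      & stored s n rs m']).
Proof.
move=> [Hm mS mW] rs0 sm; have U := small_uniform sm.
have Hr : heap s (sers rs ++ [::]) m by rewrite cats0.
have rs_gt0 : (0 < size rs)%N by case: (rs) rs0.
pose X := [:: vJ; vAcc; vCnt; vMin; vBest].
pose good m' := frame X m m' /\ forall i, m' (Posz i) = m (Posz i).
pose at_j j m' := good m' /\ m' (Negz vJ) = Posz (s + j * ser_size n).
pose Inv (j : nat) (m' : memory) := at_j j m' /\ exists b,
  [/\ (b < size rs)%N, m' (Negz vBest) = Posz (s + b * ser_size n),
      m' (Negz vMin) = rec_area (nth leaf_record rs b)
    & forall i, (i < j)%N ->
        rec_area (nth leaf_record rs b) <= rec_area (nth leaf_record rs i)].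
have area_j j m' : (j < size rs)%N -> at_j j m' ->
    wp area_loop (60 * n + 60) m' (fun m2 =>
      [/\ m2 (Negz vAcc) = rec_area (nth leaf_record rs j), at_j j m2 & frame [:: vAcc; vCnt] m' m2]).
  move=> jr [[F H] J]; have H' : heap s (sers rs ++ [::]) m'.
    by apply: heap_eq Hr _ _ => //; rewrite F.
  have := wp_area_loop (heap_at_record H' U jr J) (sm _ (mem_nth _ jr)).
  move=> W; apply: wp_mono W _ => m2 [A2 F2 H2]; split=> //.
  split; [split|by rewrite F2]; last by move=> i; rewrite H2.
  by apply: (frame_trans F); by_frame.
apply: (@wp_seq (at_j 0%N) 10 (size rs * (60 * n + 200) + 60 * n + 150)); last by lia.
  apply: wp_run => //; split; [split=> //; exact: frame_update|].
  by rewrite /= updE /= mS mul0n addn0.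
move=> m1 J1.
apply: (wp_seq (T2 := (size rs * (60 * n + 200) + 60)%N) (area_j _ _ rs_gt0 J1)); last by lia.
move=> m2 [A2 [[F2 H2] J2] _].
apply: (@wp_seq (Inv 0%N) 20 (size rs * (60 * n + 200) + 40)); last by lia.
  apply: wp_run => //=; split.
    split; [split=> //|by rewrite !updE].
    by do 2 (apply: frame_update; first by []).
  by exists 0%N; split; rewrite ?updE.
move=> m3 I3; apply: (@wp_mono _ _ _ (Inv (size rs))); last first.
  move=> m' [[[F H] J] [b [br B M mi]]]; exists b; split=> //.
  split; [|by rewrite F|by rewrite F].
  by apply: heap_eq Hm _ _ => //; rewrite F.
apply: (@wp_while _ _ _ (60 * n + 150) _ _ Inv) => //.
- move=> j m4 jr [J4 [b [br B4 M4 mi4]]]; split.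
    case: J4 => [[F4 _] J4]; rewrite /= J4 (F4 vF) //; case: Hm => _ ->.
    rewrite (size_sers U).
    have : (j.+1 * ser_size n <= size rs * ser_size n)%N by rewrite leq_mul2r jr orbT.
    by rewrite mulSn {1}/ser_size; lia.
  apply: (wp_seq (T2 := 90) (area_j _ _ jr J4)); last by lia.
  move=> m5 [A5 [[F5 H5] J5] F45].
  apply: (@wp_seq (fun m6 => [/\ good m6, m6 (Negz vJ) = Posz (s + j * ser_size n)
    & exists b, [/\ (b < size rs)%N, m6 (Negz vBest) = Posz (s + b * ser_size n),
      m6 (Negz vMin) = rec_area (nth leaf_record rs b)
    & forall i, (i < j.+1)%N ->
        rec_area (nth leaf_record rs b) <= rec_area (nth leaf_record rs i)]]) 60 30) => //.
    apply: wp_run => //=; rewrite (F45 vMin) // A5 M4; case: ifP => lt.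
      split; [split=> //; by do 2 (apply: frame_update; first by [])|by rewrite !updE|].
      exists j; rewrite !updE /= J5; split=> // i; rewrite ltnS leq_eqVlt.
      by case/orP=> [/eqP->//|/mi4]; move: lt; lia.
    split=> //; exists b; rewrite (F45 vBest) // (F45 vMin) //; split=> // i.
    by rewrite ltnS leq_eqVlt => /orP[/eqP->|/mi4 //]; move: lt; lia.
  move=> m6 [[F6 H6] J6 [c [cr B6 M6 mi6]]]; apply: wp_run => //=; split.
    split; [split=> //; by apply: frame_update|].
    by rewrite !updE /= J6 (F6 vW) // mW -PoszD; congr Posz; lia.
  by exists c; rewrite !updE.
- move=> m4 [[[F4 _] J4] _]; rewrite /= J4 (F4 vF) //; case: Hm => _ ->.
  by rewrite (size_sers U) subrr.
- by rewrite /=; lia.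
Qed.

(* The cells written to have smaller addresses than those still to be read. *)
Definition output : program :=
  Seq (block [:: set vSrc (Add (var vBest) (num 4)); set vEnd (Add (var vBest) (var vW));
                 set vJ (num 0)])
    (WhilePos (Defs.Sub (var vEnd) (var vSrc))
      (block [:: Write (var vJ) (Read (var vSrc)); set vJ (Add (var vJ) (num 1));
                 set vSrc (Add (var vSrc) (num 1))])).

Lemma wp_output s n rs b m :
  stored s n rs m -> uniform n rs -> (b < size rs)%N ->
  m (Negz vBest) = Posz (s + b * ser_size n) ->
  wp output (100 * n + 100) m (fun m' => forall i, (i < 2 * n)%N ->
    m' (Posz i) = nth 0 (flat (pts (nth leaf_record rs b))) i).
Proof.
move=> [[Hm _] mS mW] U br mB; set o := (s + b * ser_size n + 4)%N.
have rd j : (j < 2 * n)%N ->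
    m (Posz (o + j)) = nth 0 (flat (pts (nth leaf_record rs b))) j.
  move=> jn; have j4 : (4 + j < ser_size n)%N by rewrite /ser_size; lia.
  rewrite -[RHS]/(nth 0 (ser (nth leaf_record rs b)) (4 + j)).
  rewrite -(nth_sers [::] U br j4) cats0.
  rewrite /o -addnA -addnA Hm // (size_sers U).
  have : (b.+1 * ser_size n <= size rs * ser_size n)%N by rewrite leq_mul2r br orbT.
  by rewrite mulSn; lia.
pose Inv (j : nat) (m' : memory) :=
  [/\ m' (Negz vSrc) = Posz (o + j), m' (Negz vEnd) = Posz (o + 2 * n),
  m' (Negz vJ) = Posz j,
  forall i, (i < j)%N -> m' (Posz i) = nth 0 (flat (pts (nth leaf_record rs b))) i
  & forall i, (j <= i)%N -> m' (Posz i) = m (Posz i)].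
apply: (@wp_seq (Inv 0%N) 30 (100 * n + 60)); last by lia.
  apply: wp_run => //=; split; rewrite ?updE //=.
  - by rewrite mB addn0 -PoszD.
  - by rewrite mB mW -PoszD /o /ser_size; congr Posz; lia.
move=> m0 I0; apply: (@wp_mono _ _ _ (Inv (2 * n)%N)); last by move=> m' [].
apply: (@wp_while _ _ _ 30 _ _ Inv) => //.
- move=> j m1 jn [S1 E1 J1 O1 H1]; split; first by rewrite /= S1 E1; lia.
  apply: wp_run => //=; rewrite J1; split=> [||| i ij| i ij]; rewrite !updE /=.
  + by rewrite S1 -PoszD; congr Posz; lia.
  + by rewrite E1.
  + by rewrite J1; lia.
  + case: eqP => [->|ne]; last by apply: O1; lia.
    by rewrite S1 H1 ?rd // leq_addl.
  + by rewrite ifF; [apply: H1|apply/eqP]; lia.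
- by move=> m1 [S1 E1 _ _ _]; rewrite /= S1 E1 subrr.
- by rewrite /=; lia.
Qed.

(** The input is saved in [vK] first, since the heap starts at address 0 and overwrites it. The six
    zeros are [ser leaf_record], of length [ser_size 1]. *)
Definition initialize : program :=
  Seq (block [:: set vK (Read (num 0)); set vW (num 6); set vS (num 0); set vF (num 0)])
    (block (map push (nseq 6 (num 0)))).

Lemma wp_initialize h :
  wp initialize 200 (input_memory h) (fun m =>
    stored 0 (num_nodes 1) (level 1) m /\ m (Negz vK) = h%:Z).
Proof.
apply: (@wp_seq (fun m => [/\ heap 0 [::] m, m (Negz vS) = 0, m (Negz vW) = 6
   & m (Negz vK) = h%:Z]) 30 120) => //; first by apply: wp_run.
move=> m1 [H1 S1 W1 K1].
apply: wp_mono (wp_time (wp_pushes (vs := nseq 6 0) H1 _ _) _) _ => // m2 [H2 F2].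
by rewrite F2 //; split=> //; split=> //; rewrite F2.
Qed.

Definition levels_loop : program :=
  WhilePos (Defs.Sub (var vK) (num 1))
    (Seq level_step (set vK (Defs.Sub (var vK) (num 1)))).

Lemma num_nodes_mono h k : (h <= k)%N -> (num_nodes h <= num_nodes k)%N.
Proof. by move=> hk; rewrite leq_div2r // leq_sub2r // leq_pexp2l. Qed.

(** This bounds the number of level steps by the number of nodes. *)
Lemma leq_num_nodes h : (h <= num_nodes h)%N.
Proof. by elim: h => // h IH; rewrite num_nodesS; lia. Qed.

Lemma level_admissible h : (0 < h)%N -> admissible (num_nodes h) (level h).
Proof. by move=> h0; split; [exact: level_uniq|exact: level_small]. Qed.

Lemma wp_levels_loop h m : (0 < h)%N -> m (Negz vK) = h%:Z ->
  stored 0 (num_nodes 1) (level 1) m ->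
  let N := num_nodes h in
  wp levels_loop (N * (step_time N + 50) + 50) m (fun m' =>
    exists s, stored s N (level h) m').
Proof.
move=> h0 mK st N.
pose Inv (j : nat) (m' : memory) := (exists s, stored s (num_nodes j.+1) (level j.+1) m')
  /\ m' (Negz vK) = h%:Z - j%:Z.
apply: (@wp_mono _ _ _ (Inv h.-1)); last by move=> m' []; rewrite prednK.
apply: (@wp_while _ _ _ (step_time N + 20) _ _ Inv).
- by split; [exists 0%N|rewrite subr0].
- move=> j m1 jh [[s st1] K1]; split; first by rewrite /= K1; lia.
  (* Every level is charged the time of the last one, where [N] is the number of nodes. *)
  have nN : (3 * num_nodes j.+1 + 1 <= N)%N.
    by rewrite -num_nodesS; apply: num_nodes_mono; lia.
  have ad := @level_admissible j.+1 isT.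
  apply: (wp_seq (T2 := 10) (wp_level_step ad nN (joins_small ad.2) st1)); last by lia.
  move=> m2 [[s' [H2 S2 W2]] K2]; apply: wp_run => //=; split.
    exists s'; rewrite num_nodesS levelS //; split; rewrite ?updE //.
  by rewrite !updE /= K2 K1 -addn1 PoszD; ring.
- by move=> m1 [_ K1]; rewrite /= K1; lia.
- rewrite /=; have := leq_num_nodes h; rewrite -/N => hN.
  have : (h.-1 * (step_time N + 50) <= N * (step_time N + 50))%N.
    by apply: leq_mul => //; lia.
  by lia.
Qed.

Definition solver : program :=
  Seq initialize (Seq levels_loop (Seq minimum output)).

Definition solver_time (N : nat) : nat :=
  (N * (step_time N + 50) + N ^ 3 * (60 * N + 200) + 160 * N + 550)%N.

Lemma wp_solver h : (0 < h)%N ->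
  wp solver (solver_time (num_nodes h)) (input_memory h) (fun m =>
    exists2 D, min_area_drawing12 h D & outputs m D).
Proof.
move=> h0; have [ul sl] := level_admissible h0; have := size_small ul sl.
set N := num_nodes h => szl.
pose T2 := (N ^ 3 * (60 * N + 200) + 160 * N + 300)%N.
apply: (wp_seq (T2 := (N * (step_time N + 50) + 50 + T2)%N) (wp_initialize h));
  last by rewrite /solver_time /T2; lia.
move=> m1 [st1 K1]; apply: (wp_seq (T2 := T2) (wp_levels_loop h0 K1 st1)); last by [].
move=> m2 [s st2].
apply: (wp_seq (T2 := (100 * N + 100)%N) (wp_minimum st2 (level_neq0 h0) sl)); last first.
  have : (size (level h) * (60 * N + 200) <= N ^ 3 * (60 * N + 200))%N by rewrite leq_mul.
  by rewrite /T2; lia.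
move=> m3 [b [bl B3 mi st3]].
apply: wp_mono (wp_output st3 (small_uniform sl) bl B3) _ => m4 O4.
have [|D minD eD] := level_min h0 (mem_nth leaf_record bl).
  by move=> R /(nthP leaf_record)[i il <-]; exact: mi.
exists D => // i; rewrite eD size_flat (small_uniform sl) ?mem_nth //.
exact: O4.
Qed.

(** * Polynomial time bound *)

Definition is_poly (f : nat -> nat) : Prop :=
  exists p : {poly nat}, forall n, f n = p.[n].

Lemma is_poly_const c : is_poly (fun=> c).
Proof. by exists c%:P => n; rewrite hornerC. Qed.

Lemma is_poly_id : is_poly id.
Proof. by exists 'X => n; rewrite hornerX. Qed.

Lemma is_poly_add f g : is_poly f -> is_poly g -> is_poly (fun n => f n + g n)%N.
Proof. by move=> [p fp] [q gq]; exists (p + q) => n; rewrite hornerD fp gq. Qed.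

Lemma is_poly_mul f g : is_poly f -> is_poly g -> is_poly (fun n => f n * g n)%N.
Proof. by move=> [p fp] [q gq]; exists (p * q) => n; rewrite hornerM fp gq. Qed.

Lemma is_poly_solver_time : is_poly solver_time.
Proof.
rewrite /solver_time /step_time /loop_time /candidate_time.
(* The cubes are recognized as products by unfolding. *)
by repeat first [ apply: is_poly_const | apply: is_poly_id | apply: is_poly_add
  | apply: is_poly_mul ].
Qed.

Theorem theorem5 :
  exists (P : program) (p : {poly nat}),
    forall h : nat, (0 < h)%N ->
      exists (t : nat) (m : memory) (D : drawing),
        [/\ exec P (input_memory h) t m,
            (t <= p.[num_nodes h])%N,
            min_area_drawing12 h D
          & outputs m D].
Proof.
have [p pT] := is_poly_solver_time.
exists solver, p => h h0; have [t [m [e tT [D minD out]]]] := wp_solver h0.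
by exists t, m, D; rewrite -pT.
Qed.
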